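(* Let $1<p<n$ and $D=B_1(0)\subset\mathbf{R}^n$. For every $1\le r<\frac np$ and every $\delta>0$ there is a potential $V_\delta$ and a nontrivial solution $u\in W_0^{1,p}(D)$ of $-\Delta_p u=V_\delta|u|^{p-2}u$ with $\|V_\delta\|_r<\delta$.
   Context: $B_1(0)$ is the open unit ball. $\Delta_p u=\mathrm{div}(|\nabla u|^{p-2}\nabla u)$. The potential is real-valued and integrable, and $\|\cdot\|_r$ is the $L^r(D)$ norm. Solutions are in the distribution sense: $\int_D|\nabla u|^{p-2}\nabla u\cdot\nabla\psi\,dx=\int_D V_\delta|u|^{p-2}u\,\psi\,dx$ for all $\psi\in C_0^\infty(D)$ (with $|u|^{p-2}u$ read as $0$ where $u=0$, and likewise for the gradient). *)

(* Defs.v *)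
From HB Require Import structures.
From mathcomp Require Import all_boot all_order all_algebra.
From mathcomp Require Import all_classical all_reals all_analysis.

Set Implicit Arguments.
Unset Strict Implicit.
Unset Printing Implicit Defensive.

Import Order.TTheory GRing.Theory Num.Theory.
Import numFieldNormedType.Exports.

Local Open Scope classical_set_scope.
Local Open Scope ring_scope.

(** R^n is ['rV[R]_n].  Its sigma-algebra is the product one, as for
    [n.-tuple] in the library; it is the Borel sigma-algebra. *)
Section rV_measurable.
Context {R : realType}.
Variable n : nat.

Definition rV_coord (i : 'I_n) (x : 'rV[R]_n) : R := x 0 i.

Let rV_set0 : g_sigma_preimage rV_coord set0.
Proof. exact: sigma_algebra0. Qed.

Let rV_setC A : g_sigma_preimage rV_coord A -> g_sigma_preimage rV_coord (~` A).
Proof. exact: sigma_algebraC. Qed.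

Let rV_bigcup (F : _^nat) : (forall i, g_sigma_preimage rV_coord (F i)) ->
  g_sigma_preimage rV_coord (\bigcup_i (F i)).
Proof. exact: sigma_algebra_bigcup. Qed.

HB.instance Definition _ := @isMeasurable.Build default_measure_display
  'rV[R]_n (g_sigma_preimage rV_coord) rV_set0 rV_setC rV_bigcup.

End rV_measurable.

Lemma measurable_rV_coord (R : realType) n (i : 'I_n) :
  measurable_fun [set: 'rV[R]_n] (fun x : 'rV[R]_n => x 0 i).
Proof.
move=> _ Y mY; rewrite setTI; apply: sub_sigma_algebra => /=.
rewrite -bigcup_seq/=; exists i => /=; first by rewrite mem_index_enum.
by exists Y => //; rewrite setTI.
Qed.

Lemma measurable_fun_rVP d (T : measurableType d) (R : realType) n
    (f : T -> 'rV[R]_n) :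
  (forall i, measurable_fun [set: T] (fun t => f t 0 i)) ->
  measurable_fun [set: T] f.
Proof.
move=> mf.
suff H : g_sigma_preimage (fun i t => f t 0 i) `<=` measurable.
  have E : g_sigma_preimage (fun i t => f t 0 i) =
      preimage_set_system setT f (g_sigma_preimage (@rV_coord R n)).
    exact: (g_sigma_preimage_comp (@rV_coord R n) f).
  by move=> _ A mA; apply: H; rewrite E; exists A.
apply: smallest_sub; first exact: sigma_algebra_measurable.
case: n => [|n] in f mf *; first by rewrite big_ord0.
rewrite -bigcup_mkord_ord; apply: bigcup_sub => i Ii.
by move=> A [B mB <-]; exact: mf.
Qed.

Definition rV_cons (R : realType) n (z : R * 'rV[R]_n) : 'rV[R]_n.+1 :=
  \row_i (if unlift ord0 i is Some j then z.2 0 j else z.1).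

Definition rV_uncons (R : realType) n (x : 'rV[R]_n.+1) : R * 'rV[R]_n :=
  (x 0 ord0, \row_j x 0 (lift ord0 j)).

Lemma rV_consK (R : realType) n : cancel (@rV_cons R n) (@rV_uncons R n).
Proof.
move=> [a v]; rewrite /rV_uncons mxE unlift_none; congr (_, _).
by apply/rowP => j; rewrite !mxE liftK.
Qed.

Lemma measurable_rV_cons (R : realType) n :
  measurable_fun [set: R * 'rV[R]_n] (@rV_cons R n).
Proof.
apply: measurable_fun_rVP => i; rewrite /rV_cons.
under eq_fun do rewrite mxE.
case: (unlift ord0 i) => [j|]; last exact: measurable_fst.
apply: (measurableT_comp (@measurable_rV_coord R n j)).
exact: measurable_snd.
Qed.

Lemma measurable_rV_uncons (R : realType) n :
  measurable_fun [set: 'rV[R]_n.+1] (@rV_uncons R n).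
Proof.
apply: measurable_fun_pair; first exact: measurable_rV_coord.
apply: measurable_fun_rVP => j.
under eq_fun do rewrite mxE.
exact: measurable_rV_coord.
Qed.

Section lebesgue_rV_step.
Context {R : realType}.
Variables (n : nat) (m : {sigma_finite_measure set 'rV[R]_n -> \bar R}).

Definition lebesgue_rVS : set 'rV[R]_n.+1 -> \bar R :=
  pushforward (@lebesgue_measure R \x m)%E (@rV_cons R n).

HB.instance Definition _ := Measure.copy lebesgue_rVS
  (measure_function_pushforward__canonical__measure_function_Measure
    (@lebesgue_measure R \x m)%E (@measurable_rV_cons R n)).

Let sigma_finite_lebesgue_rVS : sigma_finite setT lebesgue_rVS.
Proof.
have /sigma_finiteP[F [TF ndF Foo]] := sigma_finiteT (@lebesgue_measure R).
have /sigma_finiteP[G [TG ndG Goo]] := sigma_finiteT m.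
exists (fun k => @rV_uncons R n @^-1` (F k `*` G k)).
  rewrite -preimage_bigcup -(preimage_setT (@rV_uncons R n)); congr (_ @^-1` _).
  rewrite -setXTT TF TG; apply/seteqP; split=> -[x y].
    move=> [/= [j _ Fjx] [k _ Gky]]; exists (maxn j k) => //; split.
      by move: x Fjx; exact/subsetPset/ndF/leq_maxl.
    by move: y Gky; exact/subsetPset/ndG/leq_maxr.
  by move=> [k _ []/= ? ?]; split; exists k.
move=> k; have [mF Fk] := Foo k; have [mG Gk] := Goo k; split.
  rewrite -[X in measurable X]setTI; apply: measurable_rV_uncons => //.
  exact: measurableX.
rewrite /lebesgue_rVS /pushforward -comp_preimage.
rewrite (_ : _ \o _ = id) ?preimage_id; last first.
  by apply/funext => z /=; rewrite rV_consK.
by rewrite product_measure1E// lte_mul_pinfty// ge0_fin_numE.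
Qed.

HB.instance Definition _ := Measure_isSigmaFinite.Build _ _ _
  lebesgue_rVS sigma_finite_lebesgue_rVS.

End lebesgue_rV_step.

(** Lebesgue measure on R^n: the n-fold product of Lebesgue measure on R. *)
Fixpoint lebesgue_rV (R : realType) (n : nat) :
    {sigma_finite_measure set 'rV[R]_n -> \bar R} :=
  match n with
  | 0%N => \d_(0 : 'rV[R]_0)
  | k.+1 => lebesgue_rVS (lebesgue_rV R k)
  end.
Arguments lebesgue_rV {R} n.

Lemma lebesgue_rV_box (R : realType) n (A : 'I_n -> set R) :
  (forall i, measurable (A i)) ->
  lebesgue_rV n [set x | forall i, A i (x 0 i)] =
  (\prod_(i < n) lebesgue_measure (A i))%E.
Proof.
elim: n A => [|n IH] A mA.
  by rewrite big_ord0 /= diracE mem_set//= => -[].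
have mB : measurable [set x : 'rV[R]_n | forall i, A (lift ord0 i) (x 0 i)].
  rewrite (_ : [set x | _] = \bigcap_(i in [set: 'I_n])
      ((fun x : 'rV[R]_n => x 0 i) @^-1` A (lift ord0 i))); last first.
    by apply/seteqP; split=> x /= Ax i; [move=> _|]; exact: Ax.
  apply: fin_bigcap_measurable => // i _.
  by rewrite -[X in measurable X]setTI; exact: measurable_rV_coord.
rewrite big_ord_recl -(IH (fun i => A (lift ord0 i)))//=.
rewrite /lebesgue_rVS /pushforward -product_measure1E//; last exact: mA.
congr (_ _); apply/seteqP; split=> -[a v] /=.
  move=> Av; split; first by have := Av ord0; rewrite mxE unlift_none.
  by move=> i; have := Av (lift ord0 i); rewrite mxE liftK.
by move=> [Aa Av] i; rewrite mxE; case: unliftP => [j|] ->.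
Qed.

Section calculus.
Context {R : realType} {n : nat}.
Implicit Types (x y : 'rV[R]_n) (D : set 'rV[R]_n) (f : 'rV[R]_n -> R).

(* The library norm on ['rV[R]_n] is the sup norm. *)
Definition dotr x y : R := \sum_(i < n) x 0 i * y 0 i.
Definition enorm x : R := Num.sqrt (dotr x x).
Definition unit_ball : set 'rV[R]_n := [set x | enorm x < 1].

Definition partial (i : 'I_n) f : 'rV[R]_n -> R :=
  fun x => 'D_(delta_mx 0 i) f x.
Definition grad f : 'rV[R]_n -> 'rV[R]_n := fun x => \row_i partial i f x.

Fixpoint Ck (k : nat) f : Prop :=
  match k with
  | 0%N => continuous f
  | k'.+1 => continuous f /\
      forall i, (forall x, derivable f x (delta_mx 0 i)) /\ Ck k' (partial i f)
  end.

Definition smooth f : Prop := forall k, Ck k f.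

(** [C_0^oo(D)], its elements being extended by zero to R^n. *)
Definition test_fun D f : Prop :=
  [/\ smooth f, compact (closure [set x | f x != 0]) &
      closure [set x | f x != 0] `<=` D].

Definition LnormD D (r : R) f : \bar R :=
  'N[lebesgue_rV n]_r%:E [EFin \o (f \_ D)].

Definition LpD D (r : R) f : Prop := f \_ D \in Lfun (lebesgue_rV n) r%:E.

(** [G] is the gradient of [u] on [D] in the distribution sense, for [u] and
    [G] locally integrable on [D] (ensured by [sobolev] below). *)
Definition weak_grad D (u : 'rV[R]_n -> R) (G : 'rV[R]_n -> 'rV[R]_n) : Prop :=
  forall psi i, test_fun D psi ->
    \int[lebesgue_rV n]_(x in D) (u x * partial i psi x) =
    - \int[lebesgue_rV n]_(x in D) (G x 0 i * psi x).

Definition sobolev D (p : R) (u : 'rV[R]_n -> R) (G : 'rV[R]_n -> 'rV[R]_n) :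
    Prop :=
  [/\ LpD D p u, forall i, LpD D p (fun x => G x 0 i) & weak_grad D u G].

(** [u] is in [W_0^{1,p}(D)], the closure of [C_0^oo(D)] in [W^{1,p}(D)],
    and [G] is (a representative of) its gradient. *)
Definition sobolev0 D (p : R) (u : 'rV[R]_n -> R) (G : 'rV[R]_n -> 'rV[R]_n) :
    Prop :=
  sobolev D p u G /\
  exists phi : nat -> 'rV[R]_n -> R,
    [/\ forall k, test_fun D (phi k),
        (fun k => LnormD D p (fun x => phi k x - u x)) @ \oo --> 0%E &
        (fun k => LnormD D p (fun x => enorm (grad (phi k) x - G x)))
          @ \oo --> 0%E].

(** [u], with gradient [G], solves [- Delta_p u = V |u|^(p-2) u] on [D] in the
    distribution sense.  Integrability is required explicitly because the
    library integral is also defined on functions that are not integrable.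
    Since [0 `^ a] is [0] or [1], the products [0 `^ (p - 2) * 0] are [0]. *)
Definition p_laplace_solution D (p : R) (V u : 'rV[R]_n -> R)
    (G : 'rV[R]_n -> 'rV[R]_n) : Prop :=
  forall psi, test_fun D psi ->
    let lhs := fun x => enorm (G x) `^ (p - 2) * dotr (G x) (grad psi x) in
    let rhs := fun x => V x * (`|u x| `^ (p - 2) * u x) * psi x in
    [/\ (lebesgue_rV n).-integrable D (EFin \o lhs),
        (lebesgue_rV n).-integrable D (EFin \o rhs) &
        \int[lebesgue_rV n]_(x in D) lhs x = \int[lebesgue_rV n]_(x in D) rhs x].

End calculus.
Arguments unit_ball {R} n.

(* Main.v *)
(** For a radial function [u] it is enough to prescribe the p-flux
    [|grad u|^(p-2) grad u = - h(|x|^2) x].  Take [h(s) = step(s/E) s^(-n/2)] with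
    [step] smooth, [0] before [1] and [1] after [2], and [u = 0] on the unit
    sphere.  Then [u] is constant for [|x|^2 <= E], is positive in the ball, and
    is an affine function of the p-harmonic [|x|^(-(n-p)/(p-1))] for
    [|x|^2 >= 2E].  So [V = - Delta_p u / u^(p-1)] lives on a shell of radius of
    order [E^(1/2)], where [u >= c E^(-(n-p)/(2(p-1)))] gives
    [|V| <= C E^(-p/2)].  Therefore [||V||_r <= C' E^((n/r - p)/2)], which tends
    to [0] with [E] because [r < n/p].

    Building [step] out of [exp(-1/t)] makes [step^(1/(p-1))], hence [u], smooth;
    then [theta(k u)/k], for a smooth [theta] that vanishes before [1] and is
    asymptotic to the identity, are test functions converging to [u] in
    [W^{1,p}]. *)

Require Import Defs.
From mathcomp Require Import all_boot all_order all_algebra.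
From mathcomp Require Import all_classical all_reals all_analysis.
From mathcomp Require Import measurable_realfun ring lra.

Set Implicit Arguments.
Unset Strict Implicit.
Unset Printing Implicit Defensive.

Import Order.TTheory GRing.Theory Num.Theory.
Import numFieldNormedType.Exports.
Local Open Scope classical_set_scope.
Local Open Scope ring_scope.

(** * Directional C^k calculus *)

(** Prescribing the flux instead of [u] makes the divergence an explicit radial expression; the
    nonlinearity is pushed into recovering the slope of [u], which costs a [(p-1)]-th root. Such a
    root of a smooth function is in general not smooth at a zero; for [exp(-1/t)] it is
    [exp(-1/((p-1)t))], the same function rescaled. Profiles are functions of [|x|^2], not of [|x|],
    to stay smooth at the origin, and each singular power of [|x|^2] comes with a factor that
    vanishes near 0. As [u], its flux and the approximants are classically differentiable, the weak
    gradient and the weak equation both reduce to one integration by parts, that is, to Fubini and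
    the one-variable fundamental theorem. The threshold [n/p] is the scaling one:
    [E^(-p/2) W(x/E^(1/2))] has an [L^(n/p)] norm independent of [E], and every smaller exponent
    gains a positive power of [E]. *)

Lemma continuous_add {R : realType} {T : topologicalType} (f g : T -> R) :
  continuous f -> continuous g -> continuous (f \+ g).
Proof. by move=> cf cg x; apply: continuousD; [exact: cf|exact: cg]. Qed.

Lemma continuous_mul {R : realType} {T : topologicalType} (f g : T -> R) :
  continuous f -> continuous g -> continuous (f \* g).
Proof. by move=> cf cg x; apply: continuousM; [exact: cf|exact: cg]. Qed.

Lemma continuous_compose {S T U : topologicalType} (g : T -> U) (f : S -> T) :
  continuous g -> continuous f -> continuous (g \o f).
Proof. by move=> cg cf x; apply: continuous_comp; [exact: cf|exact: cg]. Qed.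

Lemma is_derive_val {R : numFieldType} {V W : normedModType R} (f : V -> W)
  (x v : V) (a : W) : is_derive x v f a -> 'D_v f x = a.
Proof. by case. Qed.

(* [Ck] is the case [e = basis]; the case [e = 1] is the one-variable C^k. *)
Section Cdir.
Context {R : realType} {V : normedModType R} {I : Type} (e : I -> V).
Implicit Types (f g : V -> R) (k : nat).

Fixpoint Cdir k f : Prop :=
  match k with
  | 0%N => continuous f
  | k'.+1 => continuous f /\
      forall i, (forall x, derivable f x (e i)) /\ Cdir k' (fun x => 'D_(e i) f x)
  end.

Lemma Cdir_cont k f : Cdir k f -> continuous f.
Proof. by case: k => [|k] // []. Qed.

(** With [CdirP], this lets derivatives be named as explicit functions, so that the inductions on
    [k] below never handle ['D_] itself. *)
Lemma CdirS k f : continuous f ->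
  (forall i, exists g, (forall x, is_derive x (e i) f (g x)) /\ Cdir k g) ->
  Cdir k.+1 f.
Proof.
move=> cf H; split=> // i; have [g [fg kg]] := H i; split=> [x|].
  exact: (@ex_derive _ _ _ _ _ _ _ (fg x)).
rewrite (_ : (fun x => _) = g)//; apply/funext => x.
exact: (is_derive_val (fg x)).
Qed.

Lemma CdirP k f i : Cdir k.+1 f ->
  exists g, (forall x, is_derive x (e i) f (g x)) /\ Cdir k g.
Proof.
move=> [_ /(_ i)[df kf]]; exists (fun x => 'D_(e i) f x).
by split=> // x; exact/derivableP/df.
Qed.

Lemma Cdir_le k f : Cdir k.+1 f -> Cdir k f.
Proof.
elim: k f => [f [] //|k IH f Cf]; apply: (CdirS (Cdir_cont Cf)) => i.
by have [g [fg /IH Cg]] := CdirP i Cf; exists g.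
Qed.

Lemma Cdir_cst k a : Cdir k (cst a).
Proof.
elim: k a => [a|k IH a]; first exact: cst_continuous.
apply: CdirS => [|i]; first exact: cst_continuous.
by exists (cst 0); split=> // x; exact: is_derive_cst.
Qed.

Lemma Cdir_add k f g : Cdir k f -> Cdir k g -> Cdir k (f \+ g).
Proof.
elim: k f g => [|k IH] f g Cf Cg; first exact: continuous_add.
apply: CdirS => [|i]; first exact: continuous_add (Cdir_cont Cf) (Cdir_cont Cg).
have [f' [df Cf']] := CdirP i Cf; have [g' [dg Cg']] := CdirP i Cg.
by exists (f' \+ g'); split; [move=> x; exact: is_deriveD|exact: IH].
Qed.

Lemma Cdir_mul k f g : Cdir k f -> Cdir k g -> Cdir k (f \* g).
Proof.
elim: k f g => [|k IH] f g Cf Cg; first exact: continuous_mul.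
apply: CdirS => [|i]; first exact: continuous_mul (Cdir_cont Cf) (Cdir_cont Cg).
have [f' [df Cf']] := CdirP i Cf; have [g' [dg Cg']] := CdirP i Cg.
exists ((f \* g') \+ (g \* f')); split; first by move=> x; exact: is_deriveM.
by apply: Cdir_add; apply: IH => //; exact: Cdir_le.
Qed.

Lemma Cdir_sum k (J : finType) (F : J -> V -> R) :
  (forall j, Cdir k (F j)) -> Cdir k (fun x => \sum_j F j x).
Proof.
move=> CF; rewrite (_ : (fun x => _) = \big[(fun f g => f \+ g)/cst 0]_j F j).
  by elim/big_ind : _ => //; [exact: Cdir_cst|exact: Cdir_add].
by apply/funext => x; elim/big_rec2 : _ => // j f1 f2 _ ->.
Qed.

End Cdir.

Definition C1 {R : realType} (k : nat) (f : R -> R) : Prop :=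
  Cdir (fun _ : unit => 1 : R) k f.

Section chain.
Context {R : realType} {V : normedModType R}.

Lemma derive_line (f : V -> R) (x v : V) :
  'D_v f x = 'D_1 (fun t : R => f (t *: v + x)) 0.
Proof.
rewrite /derive; set g1 := fun h => h^-1 *: _; set g2 := fun h => h^-1 *: _.
suff -> : g1 = g2 by [].
by rewrite funeqE /g1 /g2 => h /=; rewrite addr0 scale0r add0r [_%:A]mulr1.
Qed.

(** Restricting [f] to the line through [x] along [v] reduces this to the one-variable chain rule;
    [f] is only assumed derivable along [v], not Frechet differentiable. *)
Lemma is_derive_comp_dir (f : V -> R) (h : R -> R) (x v : V) (a b : R) :
  is_derive (f x) 1 h a -> is_derive x v f b -> is_derive x v (h \o f) (a * b).
Proof.
move=> dh [df fb].
pose f1 (t : R) := f (t *: v + x).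
have df1 : is_derive (0 : R) 1 f1 b.
  by split; [exact: (derivable1P f x v).1|rewrite -fb derive_line].
have dh1 : is_derive (f1 0) 1 h a by rewrite /f1 scale0r add0r.
have [d1 d2] := is_derive1_comp dh1 df1.
by split; [exact: (derivable1P _ x v).2|rewrite derive_line -d2].
Qed.

Lemma Cdir_comp {I : Type} (e : I -> V) k (h : R -> R) (f : V -> R) :
  C1 k h -> Cdir e k f -> Cdir e k (h \o f).
Proof.
elim: k h f => [|k IH] h f Ch Cf; first exact: continuous_compose.
apply: CdirS => [|i]; first exact: continuous_compose (Cdir_cont Ch) (Cdir_cont Cf).
have [f' [df Cf']] := CdirP i Cf; have [h' [dh Ch']] := CdirP tt Ch.
exists ((h' \o f) \* f'); split; first by move=> x; exact: is_derive_comp_dir.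
by apply: Cdir_mul => //; apply: IH => //; exact: Cdir_le.
Qed.

Lemma is_derive_near0 (f : V -> R) (x v : V) : (\forall y \near x, f y = 0) ->
  is_derive x v f 0.
Proof.
move=> f0; apply: (@near_eq_is_derive _ _ _ (cst 0)).
by apply: filterS f0 => y ->.
Qed.

Lemma derive_near0 (f : V -> R) (x v : V) : (\forall y \near x, f y = 0) ->
  'D_v f x = 0.
Proof. by move=> /is_derive_near0 /is_derive_val. Qed.

End chain.

(** * Powers and flat functions *)

Lemma is_derive1_continuous {R : realType} (f : R -> R) (x a : R) :
  is_derive x 1 f a -> {for x, continuous f}.
Proof. by case=> /derivable1_diffP /differentiable_continuous. Qed.

Section powR_smooth.
Context {R : realType} {V : normedModType R} {I : Type} (e : I -> V).

Lemma continuous_mul_powR (f g : V -> R) (c : R) : continuous f -> continuous g ->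
  (forall x, 0 < g x \/ \forall y \near x, f y = 0) ->
  continuous (fun x => f x * g x `^ c).
Proof.
move=> cf cg fg x; have [gx|fx] := fg x.
  have cp : {for x, continuous (fun y => g y `^ c)}.
    apply: (@continuous_comp _ _ _ g (fun y => y `^ c)); first exact: cg.
    exact: is_derive1_continuous (is_derive1_powR c gx).
  exact: (@continuousM _ _ f (fun y => g y `^ c) x (cf x) cp).
have E : f x * g x `^ c = 0 by rewrite (nbhs_singleton fx) mul0r.
rewrite /continuous_at E; apply: (@cvg_trans _ ((cst (0 : R)) @ x)); last exact: cvg_cst.
by apply: near_eq_cvg; apply: filterS fx => y ->; rewrite mul0r.
Qed.

(** Products [f * g^c] are closed under differentiation: the derivative is
    [f' g^c + (c f g') g^(c-1)], and both new prefactors satisfy the same dichotomy. Hence the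
    induction is over all [f] and [c]. Where [g] may fail to be positive, the local vanishing of [f]
    hides the singularity of the power. *)
Lemma Cdir_mul_powR k (f g : V -> R) (c : R) : Cdir e k f -> Cdir e k g ->
  (forall x, 0 < g x \/ \forall y \near x, f y = 0) ->
  Cdir e k (fun x => f x * g x `^ c).
Proof.
elim: k f c => [|k IH] f c Cf Cg fg; first exact: continuous_mul_powR.
apply: CdirS => [|i].
  exact: continuous_mul_powR (Cdir_cont Cf) (Cdir_cont Cg) fg.
have [f' [df Cf']] := CdirP i Cf; have [g' [dg Cg']] := CdirP i Cg.
exists ((fun x => f' x * g x `^ c) \+
        (fun x => (c * (f x * g' x)) * g x `^ (c - 1))); split => [x|].
  have [gx|fx] := fg x.
    have dp := is_derive_comp_dir (is_derive1_powR c gx) (dg x).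
    apply: is_derive_eq (is_deriveM (df x) dp) _; rewrite /= /GRing.scale /=.
    by ring.
  have f'x : f' x = 0 by rewrite -(is_derive_val (df x)) derive_near0.
  apply: is_derive_eq; first apply: is_derive_near0.
    by apply: filterS fx => y ->; rewrite mul0r.
  by rewrite /= f'x (nbhs_singleton fx) !(mul0r, mulr0) addr0.
apply: Cdir_add; apply: IH => //; try exact: Cdir_le.
- move=> x; have [gx|fx] := fg x; [by left|right].
  (* For [f'] to vanish on a neighbourhood of [x], [f] must vanish near each point [y] of that
     neighbourhood, not just at [y]. *)
  have : \forall y \near x, \forall z \near y, f z = 0 by exact: nbhs_interior fx.
  by apply: filterS => y fy; rewrite -(is_derive_val (df y)) derive_near0.
- apply: (Cdir_mul (Cdir_cst _ _ _)); apply: Cdir_mul => //.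
  exact: Cdir_le.
- move=> x; have [gx|fx] := fg x; [by left|right].
  by apply: filterS fx => y ->; rewrite mul0r mulr0.
Qed.

End powR_smooth.

Section flat.
Context {R : realType}.
Implicit Types (m : nat) (t : R).

(* This family is closed under differentiation (see [is_derive_flat]). *)
Definition flat m t : R := if 0 < t then t^-1 ^+ m * expR (- t^-1) else 0.

Lemma flat_le0 m t : t <= 0 -> flat m t = 0.
Proof. by rewrite /flat leNgt => /negbTE ->. Qed.

Lemma flat_ge0 m t : 0 <= flat m t.
Proof.
rewrite /flat; case: ifPn => // t0.
by rewrite mulr_ge0 ?expR_ge0// exprn_ge0// invr_ge0 ltW.
Qed.

Lemma flatSM m t : flat m.+1 t * t = flat m t.
Proof.
rewrite /flat; case: ifPn => t0; last by rewrite mul0r.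
by rewrite exprS; field; rewrite gt_eqF.
Qed.

(** With [z = 1/t] this says [z^m <= m^m e^z], the [m]-th power of [z/m <= e^(z/m)]. *)
Lemma flat_le m t : flat m t <= m%:R ^+ m.
Proof.
rewrite /flat; case: ifPn => [t0|_]; last by rewrite exprn_ge0.
have z0 : 0 < t^-1 by rewrite invr_gt0.
rewrite expRN ler_pdivrMr ?expR_gt0//; case: m => [|m].
  by rewrite !expr0 mul1r; apply: le_trans (expR_ge1Dx _); rewrite lerDl ltW.
have -> : expR t^-1 = (expR (t^-1 / m.+1%:R)) ^+ m.+1.
  by rewrite -expRM_natl mulrC divfK// pnatr_eq0.
rewrite -exprMn; apply: lerXn2r; rewrite ?nnegrE ?mulr_ge0 ?expR_ge0 ?(ltW z0)//.
rewrite -ler_pdivrMl ?ltr0n// mulrC.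
by apply: le_trans (expR_ge1Dx _); rewrite lerDr ler01.
Qed.

Lemma flat_lin m t : 0 < t -> flat m t <= (m.+1%:R ^+ m.+1) * t.
Proof. by move=> t0; rewrite -flatSM ler_pM2r// flat_le. Qed.

Lemma flat_continuous0 m : {for 0, continuous (flat m)}.
Proof.
rewrite /prop_for /continuous_at (flat_le0 m (lexx 0)).
apply/cvgr0Pnorm_lt => eps eps0.
pose C : R := m.+1%:R ^+ m.+1.
have C0 : 0 < C by rewrite exprn_gt0.
have N : \forall y \near (0 : R), `|y| < C^-1 * eps.
  by apply: nbhs0_lt; rewrite mulr_gt0// invr_gt0.
apply: filterS N => y; rewrite ltr_pdivlMl// => yC.
rewrite ger0_norm ?flat_ge0//; have [y0|y0] := ltP 0 y; last by rewrite flat_le0.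
by apply: le_lt_trans (flat_lin m y0) _; rewrite -/C -(ger0_norm (ltW y0)).
Qed.

Lemma is_derive_flat m t :
  is_derive t 1 (flat m) (flat m.+2 t - m%:R * flat m.+1 t).
Proof.
have [t0|t0|->] := ltgtP t 0.
- rewrite !flat_le0 ?(ltW t0)// mulr0 subr0; apply: is_derive_near0.
  near=> y; rewrite flat_le0//; apply/ltW; near: y; exact: lt_nbhsl.
(* For [t > 0] the function is [K(1/t)] with [K(z) = z^m e^(-z)], differentiated by the chain
   rule. *)
- pose K (z : R) := z ^+ m * expR (- z).
  have dV : is_derive t 1 (fun y : R => y^-1) (- (t^-1 ^+ 2)).
    have tn0 : t != 0 by rewrite gt_eqF.
    split; first exact: (@derivableV _ _ id).
    by rewrite (@deriveV _ _ id)// derive_id /GRing.scale /= mulr1 exprVn.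
  have dK : is_derive t^-1 1 K
      (m%:R * (t^-1) ^+ m.-1 * expR (- t^-1) - (t^-1) ^+ m * expR (- t^-1)).
    have dN : is_derive (t^-1 : R) 1 (fun z : R => - z) (- 1) by exact: is_deriveNid.
    have dE := is_derive1_comp (is_derive_expR (- t^-1)) dN.
    have dX := is_deriveX m (is_derive_id (t^-1 : R) 1).
    have := is_deriveM dX dE.
    rewrite (_ : _ * _ = K); last by apply/funext => z; rewrite /K !fctE.
    by move=> /is_derive_eq; apply; rewrite /GRing.scale /= !fctE; ring.
  have := is_derive1_comp dK dV.
  have nE : {near t, (K \o (fun y : R => y^-1)) =1 flat m}.
    near=> y; rewrite /= /K /flat ifT//; near: y; exact: lt_nbhsr.
  move=> /(near_eq_is_derive nE)/is_derive_eq; apply.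
  rewrite /flat t0; case: (m) => [|j] /=; rewrite ?expr0 ?mul0r; first by ring.
  by rewrite !exprS; ring.
(* At 0 the difference quotient of [flat m] is [flat m.+1], so the continuity of the latter at 0
   gives the derivative. *)
- rewrite !flat_le0// mulr0 subr0; apply/is_derive1_caratheodory.
  exists (flat m.+1); split; [|exact: flat_continuous0|exact: flat_le0].
  move=> z; rewrite subr0 (flat_le0 m (lexx 0)) subr0 /flat.
  case: ifPn => z0; last by rewrite mul0r.
  by rewrite exprS; field; rewrite gt_eqF.
Unshelve. all: by end_near. Qed.

Lemma C1_flat k m : C1 k (flat m).
Proof.
have cf j : continuous (flat j).
  by move=> x; exact: is_derive1_continuous (is_derive_flat j x).
elim: k m => [|k IH] m; first exact: cf.
apply: CdirS => // _; exists (flat m.+2 \+ (cst (- m%:R) \* flat m.+1)); split.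
  by move=> x; apply: is_derive_eq (is_derive_flat m x) _ => /=; rewrite mulNr.
apply: Cdir_add; first exact: IH.
by apply: Cdir_mul; [exact: Cdir_cst|exact: IH].
Qed.

End flat.

(** * Borel sets and compact cubes of R^n *)

Section rV_topology.
Context {R : realType} {n : nat}.
Implicit Types (x y : 'rV[R]_n) (f : 'rV[R]_n -> R).

Definition cube (M : R) : set 'rV[R]_n := [set x | forall i, x 0 i \in `[- M, M]].

(** Stated by coordinates, so that it passes at once to the slices of [rV_cons]. *)
Definition bounded_support f := exists M, forall x i, M < `|x 0 i| -> f x = 0.

Lemma compact_cube M : compact (cube M).
Proof.
by apply: (@rV_compact R n (fun=> `[- M, M]%classic)) => _; exact: segment_compact.
Qed.

Lemma measurable_forall_coord (A : 'I_n -> set R) : (forall i, measurable (A i)) ->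
  measurable [set x : 'rV[R]_n | forall i, A i (x 0 i)].
Proof.
move=> mA; rewrite (_ : [set x | _] = \bigcap_(i in [set: 'I_n])
    ((fun x : 'rV[R]_n => x 0 i) @^-1` A i)); last first.
  by apply/seteqP; split=> x /= Ax i; [move=> _|]; exact: Ax.
apply: fin_bigcap_measurable => // i _.
by rewrite -[X in measurable X]setTI; exact: measurable_rV_coord.
Qed.

Lemma measurable_cube M : measurable (cube M).
Proof. exact: (measurable_forall_coord (A := fun=> `[- M, M]%classic)). Qed.

Lemma lebesgue_cube M : 0 < M -> lebesgue_rV n (cube M) = ((M *+ 2) ^+ n)%:E.
Proof.
move=> M0; rewrite (lebesgue_rV_box (A := fun=> `[- M, M]%classic))//.
rewrite (eq_bigr (fun=> (M *+ 2)%:E)); last first.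
  move=> i _; rewrite lebesgue_measure_itv /= lte_fin ifT; last by rewrite gtrN.
  by rewrite -EFinB opprK mulr2n.
by rewrite prodEFin prodr_const card_ord.
Qed.

Lemma lebesgue_cube_lty M : (lebesgue_rV n (cube M) < +oo)%E.
Proof.
apply: (@le_lt_trans _ _ (lebesgue_rV n (cube (`|M| + 1)))).
  apply: le_measure; rewrite ?inE; try exact: measurable_cube.
  move=> x Mx i; have := Mx i; rewrite !in_itv /= => /andP[a b].
  have := ler_norm M; lra.
by rewrite lebesgue_cube ?ltry// ltr_wpDl.
Qed.

(** The sigma-algebra is generated by the coordinates, so an open set is exhibited as the countable
    union of the cubes with rational centre and radius [1/(k+1)] that it contains. *)
Lemma open_measurable_rV (A : set 'rV[R]_n) : open A -> measurable A.
Proof.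
move=> oA.
pose box (p : 'rV[rat]_n * nat) : set 'rV[R]_n :=
  [set x | forall i, `|x 0 i - ratr (p.1 0 i)| < p.2.+1%:R^-1].
pose F p := if `[< box p `<=` A >] then box p else set0.
have -> : A = \bigcup_p F p.
  apply/seteqP; split=> [x Ax|x [p _]]; last first.
    by rewrite /F; case: asboolP => // pA /pA.
  have /(nbhs_ballP x)[e /= e0 eA] := open_nbhs_nbhs (conj oA Ax).
  have e20 : 0 < e / 2 by rewrite divr_gt0.
  (* Two points of a cube of radius below [e/2] are within [e] of each other, so the cube around a
     rational point close to [x] stays in the ball of radius [e] at [x]. *)
  have [k] := ltr_add_invr e20; rewrite add0r => ke.
  have k0 : 0 < k.+1%:R^-1 :> R by rewrite invr_gt0.
  have q_ i : {q : rat | `|x 0 i - ratr q| < k.+1%:R^-1}.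
    apply: cid; have [|q] := @rat_in_itvoo R (x 0 i) (x 0 i + k.+1%:R^-1).
      by rewrite ltrDl.
    rewrite in_itv /= => /andP[q1 q2]; exists q.
    by rewrite distrC ger0_norm ?subr_ge0 ?(ltW q1)// ltrBlDl.
  exists (\row_i sval (q_ i), k) => //; rewrite /F asboolT.
    by move=> i /=; rewrite mxE; exact: (svalP (q_ i)).
  move=> y ybox; apply: eA; split => // j i; rewrite ord1.
  have := ybox i; rewrite /= mxE; have := svalP (q_ i); move: (sval (q_ i)) => q a b.
  rewrite /ball /= -(subrK (ratr q) (x 0 i)) -addrA.
  apply: le_lt_trans (ler_normD _ _) _; rewrite distrC in b.
  by rewrite (splitr e) ltrD// (lt_trans _ ke).
apply: countable_bigcupT_measurable => [|p]; first exact: countableP.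
rewrite /F; case: asboolP => // _.
apply: (measurable_forall_coord
  (A := fun i => [set t : R | `|t - ratr (p.1 0 i)| < p.2.+1%:R^-1])) => i.
apply: open_measurable.
rewrite (_ : [set _ | _] = ball (ratr (p.1 0 i) : R) p.2.+1%:R^-1).
  exact: ball_open.
by apply/seteqP; split=> t; rewrite /ball /= distrC.
Qed.

Lemma continuous_measurable_rV f : continuous f -> measurable_fun setT f.
Proof.
move=> /continuousP cf; apply: (measurability _ (RGenOpens.measurableE R)).
move=> _ [_ [a [b ->]] <-]; rewrite setTI.
apply: open_measurable_rV; apply: cf; exact: itv_open.
Qed.

Lemma continuous_bounded_cube f M : continuous f ->
  exists C, forall x, cube M x -> `|f x| <= C.
Proof.
move=> cf; have cn : continuous (fun x => `|f x|).
  by move=> x; apply: continuous_comp; [exact: cf|exact: norm_continuous].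
have [[x0 Mx0]|N] := pselect (cube M !=set0).
  have [c _ cmax] := compact_EVT_max (ex_intro _ x0 Mx0) (@compact_cube M)
    (continuous_subspaceT cn).
  by exists `|f c| => x Mx; apply: cmax; rewrite inE.
by exists 0 => x Mx; exfalso; apply: N; exists x.
Qed.

Lemma bounded_integrable (D : set 'rV[R]_n) (M C : R) f : measurable D -> D `<=` cube M ->
  measurable_fun D f -> (forall x, D x -> `|f x| <= C) ->
  (lebesgue_rV n).-integrable D (EFin \o f).
Proof.
move=> mD DM mf fC; apply: measurable_bounded_integrable => //.
  apply: le_lt_trans (lebesgue_cube_lty M).
  by apply: le_measure; rewrite ?inE //; exact: measurable_cube.
exists C; split; first exact: num_real.
by move=> y Cy x /fC /le_trans; apply; exact: ltW.
Qed.

Lemma continuous_integrable f : continuous f -> bounded_support f ->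
  (lebesgue_rV n).-integrable setT (EFin \o f).
Proof.
move=> cf [M fM]; have [C fC] := continuous_bounded_cube M cf.
have mf := measurable_funS measurableT (@subsetT _ (cube M))
  (continuous_measurable_rV cf).
have := bounded_integrable (measurable_cube M) (@subset_refl _ _) mf fC.
move/(integrable_mkcond _ (measurable_cube M)).
congr (_.-integrable _ _); apply/funext => x; rewrite patchE; case: ifPn => // xM.
have /existsNP[i /negP] : ~ forall i, x 0 i \in `[- M, M].
  by move=> Mx; move: xM; rewrite mem_set.
by rewrite /= in_itv /= -ler_norml -ltNge => /fM ->.
Qed.

Lemma bounded_support_derive f (v : 'rV[R]_n) : bounded_support f ->
  bounded_support (fun x => 'D_v f x).
Proof.
move=> [M fM]; exists M => x j Mx; apply: derive_near0.
have : \forall y \near x, M < `|(y : 'rV[R]_n) 0 j|.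
  have nt : {for x, continuous (fun y : 'rV[R]_n => `|y 0 j|)}.
    by apply: continuous_comp; [exact: coord_continuous|exact: norm_continuous].
  exact: (nt _ (lt_nbhsr Mx)).
by apply: filterS => y /fM.
Qed.

End rV_topology.

(** * The integral of a compactly supported derivative *)

Section integral_derivative.
Context {R : realType}.

Lemma integral_derive1_eq0 (G g : R -> R) : (forall t : R, is_derive t 1 G (g t)) ->
  continuous g -> (exists M, forall t, M < `|t| -> G t = 0) ->
  (\int[lebesgue_measure]_t (g t)%:E = 0)%E.
Proof.
move=> dG cg [M GM].
have g0 t : M < `|t| -> g t = 0.
  move=> Mt; rewrite -(is_derive_val (dG t)); apply: derive_near0.
  have : \forall y \near t, M < `|y|.
    have nt : {for t, continuous (fun y : R => `|y|)} by exact: norm_continuous.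
    exact: (nt _ (lt_nbhsr Mt)).
  by apply: filterS => y /GM.
pose N := `|M| + 1.
have N0 : 0 < N by rewrite ltr_wpDl.
have MN : M < N by rewrite ltr_pwDr// ler_norm.
have cG t : {for t, continuous G} by exact: is_derive1_continuous (dG t).
have -> : (\int[lebesgue_measure]_t (g t)%:E =
    \int[lebesgue_measure]_(t in `[(- N)%R, N]) (g t)%:E)%E.
  rewrite [RHS]integral_mkcond; apply: eq_integral => t _.
  rewrite patchE; case: ifPn => // tN; rewrite g0//.
  apply: lt_le_trans MN _; rewrite leNgt; apply: contra tN => tN.
  by rewrite mem_set//= in_itv/= -ler_norml ltW.
rewrite (@continuous_FTC2 _ g G).
- by rewrite !GM ?subee// ?normrN gtr0_norm.
- by rewrite gtrN.
- exact: continuous_subspaceT.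
- split.
  + by move=> t _; exact: (@ex_derive _ _ _ _ _ _ _ (dG t)).
  + exact/cvg_at_right_filter/cG.
  + exact/cvg_at_left_filter/cG.
- by move=> t _; rewrite derive1E; exact: (is_derive_val (dG t)).
Qed.

Definition basis n (i : 'I_n) : 'rV[R]_n := delta_mx 0 i.

Lemma continuous_rV_cons n : continuous (@rV_cons R n).
Proof.
move=> [t v] /= A /(nbhs_ballP _)[e /= e0 eA].
apply/nbhs_ballP; exists e => //= -[t' v'] [/= tt' vv'].
apply: eA; split => // j i; rewrite /rV_cons !mxE; case: unliftP => [k _|_] //=.
by case: vv' => _; apply.
Qed.

Lemma continuous_rV_consl n (v : 'rV[R]_n) : continuous (fun t : R => rV_cons (t, v)).
Proof.
move=> t; apply: (@continuous_comp _ _ _ (fun t : R => (t, v)) (@rV_cons R n)).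
  by apply: (@cvg_pair _ _ _ (nbhs t) (nbhs t) (nbhs v) _ _ _ id (cst v));
    [exact: cvg_id|exact: cvg_cst].
exact: continuous_rV_cons.
Qed.

Lemma continuous_rV_consr n (t : R) : continuous (fun v : 'rV[R]_n => rV_cons (t, v)).
Proof.
move=> v; apply: (@continuous_comp _ _ _ (fun v : 'rV[R]_n => (t, v)) (@rV_cons R n)).
  by apply: (@cvg_pair _ _ _ (nbhs v) (nbhs t) (nbhs v) _ _ _ (cst t) id);
    [exact: cvg_cst|exact: cvg_id].
exact: continuous_rV_cons.
Qed.

Lemma rV_cons_addl n (h t : R) (v : 'rV[R]_n) :
  rV_cons (h + t, v) = h *: basis ord0 + rV_cons (t, v).
Proof.
apply/rowP => i; rewrite /basis !mxE /= ?eqxx /=.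
by case: unliftP => [j|] -> /=; rewrite ?mulr1 ?mulr0 ?add0r.
Qed.

Lemma rV_cons_addr n (h t : R) (v : 'rV[R]_n) i :
  rV_cons (t, h *: basis i + v) = h *: basis (lift ord0 i) + rV_cons (t, v).
Proof.
apply/rowP => j; rewrite /basis !mxE /= ?eqxx /=.
case: unliftP => [k|] -> /=; last by rewrite ?mulr0 add0r.
by rewrite /basis !mxE /= ?eqxx (inj_eq lift_inj).
Qed.

Lemma ge0_integral_rV_cons n (f : 'rV[R]_n.+1 -> \bar R) : measurable_fun setT f ->
  (forall x, 0 <= f x)%E ->
  (\int[lebesgue_rV n.+1]_x f x =
   \int[@lebesgue_measure R \x lebesgue_rV n]_z f (rV_cons z))%E.
Proof.
move=> mf f0; rewrite /= /lebesgue_rVS ge0_integral_pushforward//.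
exact: measurable_rV_cons.
Qed.
Lemma integral_rV_cons n (f : 'rV[R]_n.+1 -> \bar R) : measurable_fun setT f ->
  (lebesgue_measure \x lebesgue_rV n)%E.-integrable setT (f \o @rV_cons R n) ->
  (\int[lebesgue_rV n.+1]_x f x =
   \int[@lebesgue_measure R \x lebesgue_rV n]_z f (rV_cons z))%E.
Proof.
move=> mf iC; rewrite /= /lebesgue_rVS integral_pushforward//.
exact: measurable_rV_cons.
Qed.

(** Fubini on the first coordinate against the rest. If [i] is the first coordinate, the inner
    integral is one-dimensional and vanishes by the fundamental theorem; otherwise the inner
    integral over the other coordinates vanishes by induction. Taking [g'] as data lets the slices
    inherit the hypotheses directly. *)
Lemma integral_partial_eq0 n (g g' : 'rV[R]_n -> R) i :
  continuous g -> continuous g' -> (forall x, is_derive x (basis i) g (g' x)) ->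
  bounded_support g -> (\int[lebesgue_rV n]_x (g' x)%:E = 0)%E.
Proof.
elim: n g g' i => [|n IH] g g' i cg cg' dg [M gM]; first by case: i dg.
have bg' : bounded_support g'.
  rewrite (_ : g' = fun x => 'D_(basis i) g x); last first.
    by apply/funext => x; rewrite (is_derive_val (dg x)).
  by apply: bounded_support_derive; exists M.
have ig' := continuous_integrable cg' bg'.
have mg' := continuous_measurable_rV cg'.
(* Fubini needs integrability for the product measure; it is transported from [lebesgue_rV n.+1] by
   the change of variables for the nonnegative function [|g'|]. *)
have iC : (@lebesgue_measure R \x lebesgue_rV n)%E.-integrable setT
    ((EFin \o g') \o @rV_cons R n).
  apply/integrableP; split.
    apply: measurableT_comp; last exact: measurable_rV_cons.
    exact/measurable_EFinP.
  have mabs : measurable_fun setT (abse \o (EFin \o g')).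
    by apply: measurableT_comp => //; exact/measurable_EFinP.
  have /integrableP[_] := ig'.
  by rewrite (ge0_integral_rV_cons mabs (fun=> abse_ge0 _)).
rewrite (integral_rV_cons _ iC); last exact/measurable_EFinP.
case: (unliftP ord0 i) dg => [j|] -> dg.
  rewrite -integral12_prod_meas1//; apply: integral0_eq => t _; rewrite /fubini_F /=.
  have ct := @continuous_rV_consr n t.
  apply: (IH (fun v => g (rV_cons (t, v))) _ j).
  - by move=> v; exact: (@continuous_comp _ _ _ _ g _ (ct v) (cg _)).
  - by move=> v; exact: (@continuous_comp _ _ _ _ g' _ (ct v) (cg' _)).
  - move=> v; have [d1 d2] := dg (rV_cons (t, v)).
    by split; [move: d1|move: d2]; rewrite /derivable /derive;
      under eq_fun do rewrite /= -rV_cons_addr.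
  - exists M => v k Mv; apply: (gM _ (lift ord0 k)).
    by rewrite mxE liftK.
rewrite -integral21_prod_meas1//; apply: integral0_eq => v _; rewrite /fubini_G /=.
have ct := @continuous_rV_consl n v.
apply: (@integral_derive1_eq0 (fun t => g (rV_cons (t, v)))).
- move=> t; have [d1 d2] := dg (rV_cons (t, v)).
  by split; [move: d1|move: d2]; rewrite /derivable /derive;
    under eq_fun do rewrite /= -rV_cons_addl;
    under [in X in _ -> X]eq_fun do rewrite /= [_ *: 1]mulr1.
- by move=> t; exact: (@continuous_comp _ _ _ _ g' _ (ct t) (cg' _)).
- exists M => t Mt; apply: (gM _ ord0).
  by rewrite mxE unlift_none.
Qed.

End integral_derivative.

(** * Integration by parts and L^p norms on a bounded set *)

Section by_parts.
Context {R : realType} {n : nat}.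
Implicit Types (f g : 'rV[R]_n -> R) (D : set 'rV[R]_n).

Lemma Ck_continuous k f : Ck k f -> continuous f.
Proof. by case: k => [|k] // []. Qed.

Lemma partialE f f' i : (forall x, is_derive x (basis i) f (f' x)) -> partial i f = f'.
Proof. by move=> df; apply/funext => x; exact: (is_derive_val (df x)). Qed.

Lemma is_derive_partial k f i x : Ck k.+1 f -> is_derive x (basis i) f (partial i f x).
Proof. by move=> [_ /(_ i)[df _]]; exact/derivableP/df. Qed.

Lemma Ck_partial k f i : Ck k.+1 f -> Ck k (partial i f).
Proof. by move=> [_ /(_ i)[]]. Qed.

Lemma test_fun_bounded_support D f : test_fun D f -> bounded_support f.
Proof.
move=> [_ /compact_bounded[M [_ MB]] _]; exists (M + 1) => x i Mx.
apply/eqP; apply: contraT => fx0.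
have xc : closure [set x | f x != 0] x by exact: subset_closure.
have /= := MB (M + 1) (ltr_pwDr ltr01 (lexx _)) x xc.
rewrite leNgt => /negP; case; apply: lt_le_trans Mx _.
by rewrite [leRHS]/Num.Def.normr /= mx_normrE; apply/bigmax_geP; right => /=; exists (0, i).
Qed.

(** Vanishing on a neighbourhood, boundary points of [D] included, also kills the partial
    derivatives off [D]; integrals over [D] thus become integrals over the whole space. *)
Lemma test_fun_near0 D f x : test_fun D f -> ~ D x -> \forall y \near x, f y = 0.
Proof.
move=> [_ _ cD] Dx.
have oC : open (~` closure [set x | f x != 0]) by rewrite openC; exact: closed_closure.
have : nbhs x (~` closure [set x | f x != 0]).
  by apply: open_nbhs_nbhs; split => // /cD.
apply: filterS => y yc; apply/eqP; apply: contraT => fy; exfalso.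
by apply: yc; exact: subset_closure.
Qed.

Lemma test_fun_partial_out D f i x : test_fun D f -> ~ D x -> partial i f x = 0.
Proof.
move=> tf Dx.
exact: derive_near0 (test_fun_near0 tf Dx).
Qed.

Lemma bounded_support_mull f g : bounded_support g -> bounded_support (f \* g).
Proof. by move=> [M gM]; exists M => x i /gM /= ->; rewrite mulr0. Qed.

Lemma Rintegral_outside0 D f : (forall x, ~ D x -> f x = 0) ->
  \int[lebesgue_rV n]_(x in D) f x = \int[lebesgue_rV n]_x f x.
Proof.
move=> f0; rewrite Rintegral_mkcond; congr (Rintegral _ _ _).
apply/funext => x; rewrite patchE; case: ifPn => // /negP xD.
by rewrite f0// => Dx; apply: xD; rewrite inE.
Qed.

(** The integral of the [i]-th derivative of [f g] vanishes. Bounded support is asked of [g] alone,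
    because [f] will be [ground] or a component of its flux, extended by their formulas to the whole
    space. *)
Lemma Rintegral_by_parts_rV f f' g i : continuous f' -> continuous f ->
  (forall x, is_derive x (basis i) f (f' x)) -> Ck 1 g -> bounded_support g ->
  \int[lebesgue_rV n]_x (f x * partial i g x) = - \int[lebesgue_rV n]_x (f' x * g x).
Proof.
move=> cf' cf df Cg bg.
have cg : continuous g := Ck_continuous Cg.
have cg' : continuous (partial i g) := Ck_continuous (Ck_partial i Cg).
have i1 := continuous_integrable (continuous_mul cf cg')
  (bounded_support_mull f (bounded_support_derive (basis i) bg)).
have i2 := continuous_integrable (continuous_mul cf' cg)
  (bounded_support_mull f' bg).
have I0 : (\int[lebesgue_rV n]_x (f x * partial i g x + f' x * g x)%:E = 0)%E.
  apply: (@integral_partial_eq0 _ _ (f \* g) _ i).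
  - exact: continuous_mul.
  - exact: continuous_add (continuous_mul cf cg') (continuous_mul cf' cg).
  - move=> x; apply: is_derive_eq (is_deriveM (df x) (is_derive_partial i x Cg)) _.
    by rewrite /GRing.scale /= [f' x * _]mulrC.
  - exact: bounded_support_mull.
by apply/eqP; rewrite -addr_eq0 -RintegralD// /Rintegral I0.
Qed.

End by_parts.

Section Lnorm_on.
Context {R : realType} {n : nat}.
Variables (D : set 'rV[R]_n) (M : R).
Hypotheses (mD : measurable D) (DM : D `<=` cube M).
Implicit Types (f : 'rV[R]_n -> R) (p C eps : R).

Lemma LnormD_poweR p f : 0 < p ->
  ((LnormD D p f) `^ p = \int[lebesgue_rV n]_(x in D) (`|f x| `^ p)%:E)%E.
Proof.
move=> p0; have pn0 : p != 0 by rewrite gt_eqF.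
rewrite /LnormD (poweR_Lnorm _ _ pn0) [RHS]integral_mkcond.
apply: eq_integral => x _; rewrite /= !patchE; case: ifPn => _ //=.
by rewrite normr0 powR0// gt_eqF.
Qed.

Lemma LnormD_lt p eps f : 0 < p -> 0 < eps ->
  (\int[lebesgue_rV n]_(x in D) (`|f x| `^ p)%:E < (eps `^ p)%:E)%E ->
  (LnormD D p f < eps%:E)%E.
Proof.
move=> p0 e0; rewrite -LnormD_poweR// -poweR_EFin !ltNge; apply: contra => H.
apply: gt0_ler_poweR => //; first exact: ltW.
- by rewrite in_itv /= lee_fin ltW //= leey.
- by rewrite in_itv /= Lnorm_ge0 leey.
Qed.

Lemma measurable_norm_powR p f : measurable_fun D f ->
  measurable_fun D (fun x => `|f x| `^ p).
Proof.
move=> mf; apply: (measurableT_comp (measurable_powR p)).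
exact: measurableT_comp.
Qed.

Lemma integrable_norm_powR p C f : 0 <= p -> measurable_fun D f ->
  (forall x, D x -> `|f x| <= C) ->
  (lebesgue_rV n).-integrable D (fun x => (`|f x| `^ p)%:E).
Proof.
move=> p0 mf fC; apply: (bounded_integrable (C := C `^ p) mD DM).
  exact: measurable_norm_powR.
move=> x Dx; rewrite ger0_norm ?powR_ge0// ge0_ler_powR// ?nnegrE//.
  exact: le_trans (fC _ Dx).
exact: fC.
Qed.

Lemma bounded_LpD p C f : 1 <= p -> measurable_fun D f ->
  (forall x, D x -> `|f x| <= C) -> LpD D p f.
Proof.
move=> p1 mf fC; have p0 : 0 < p by exact: lt_le_trans p1.
apply/andP; split; rewrite inE /=.
  by apply/(measurable_restrictT f mD).
rewrite /finite_norm; apply: (@lty_poweRy _ _ p); first by rewrite gt_eqF.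
rewrite (LnormD_poweR f p0).
have /integrableP[_] := integrable_norm_powR (ltW p0) mf fC.
rewrite (_ : (fun x => `|(`|f x| `^ p)%:E|%E) = fun x => (`|f x| `^ p)%:E)//.
by apply/funext => x /=; rewrite ger0_norm ?powR_ge0.
Qed.

(** Dominated convergence for [|f k|^p]: since [D] is bounded, the constant [C^p] is an integrable
    bound. *)
Lemma LnormD_cvg0 p C (f : nat -> 'rV[R]_n -> R) : 1 <= p ->
  (forall k, measurable_fun D (f k)) ->
  (forall k x, D x -> `|f k x| <= C) ->
  (forall x, D x -> f ^~ x @ \oo --> (0 : R)) ->
  LnormD D p (f k) @[k --> \oo] --> 0%E.
Proof.
move=> p1 mf fC f0; have p0 : 0 < p by exact: lt_le_trans p1.
pose g k x : \bar R := (`|f k x| `^ p)%:E.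
have mg k : measurable_fun D (g k) by apply/measurable_EFinP; exact: measurable_norm_powR.
have gC : {ae lebesgue_rV n, forall x k, D x -> (`|g k x| <= (C `^ p)%:E)%E}.
  apply/aeW => x k Dx; rewrite /g /= lee_fin ger0_norm ?powR_ge0//.
  by rewrite ge0_ler_powR ?nnegrE ?(ltW p0)// ?(le_trans _ (fC k _ Dx))// fC.
have g0 : {ae lebesgue_rV n, forall x, D x -> g ^~ x @ \oo --> 0%E}.
  apply/aeW => x Dx; apply/fine_cvgP; split; first exact: nearW.
  apply/cvgr0Pnorm_lt => e e0.
  have := f0 x Dx; move/cvgr0Pnorm_lt => /(_ (e `^ p^-1) (powR_gt0 _ e0)).
  apply: filterS => k fk; rewrite /= ger0_norm ?powR_ge0//.
  have := gt0_ltr_powR p0 _ _ fk; rewrite !nnegrE normr_ge0 powR_ge0 => /(_ isT isT).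
  by rewrite -powRrM mulVf ?gt_eqF// powRr1// ltW.
have iC : (lebesgue_rV n).-integrable D (cst (C `^ p)%:E).
  apply: (bounded_integrable (f := cst (C `^ p)) (C := `|C `^ p|) mD DM) => //.
have [_ _ I0] := dominated_convergence mD mg (measurable_cst _) g0 iC gC.
rewrite integral0 in I0.
have /fine_cvgP[If /cvgr0Pnorm_lt I0'] := I0.
have N_lt e : 0 < e -> \forall k \near \oo, (LnormD D p (f k) < e%:E)%E.
  move=> e0; apply: filterS2 If (I0' _ (powR_gt0 p e0)) => k Ik Ike.
  apply: LnormD_lt => //; move: (le_lt_trans (ler_norm _) Ike).
  by rewrite -lte_fin fineK.
apply/fine_cvgP; split.
  apply: filterS (N_lt 1 ltr01) => k Nk; rewrite ge0_fin_numE ?Lnorm_ge0//.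
  exact: lt_trans Nk (ltry _).
apply/cvgr0Pnorm_lt => e e0; apply: filterS (N_lt e e0) => k Nk /=.
have Nf : LnormD D p (f k) \is a fin_num.
  by rewrite ge0_fin_numE ?Lnorm_ge0// (lt_trans Nk (ltry _)).
by rewrite ger0_norm ?fine_ge0 ?Lnorm_ge0// -lte_fin fineK.
Qed.
End Lnorm_on.

(** * One-variable profiles *)

Section profile.
Context {R : realType}.
Implicit Types (t s v : R) (k : nat).

Lemma C1_id k : C1 k (id : R -> R).
Proof.
elim: k => [|k IH]; first by move=> x; exact: cvg_id.
apply: CdirS => [x|_]; first exact: cvg_id.
by exists (cst 1); split; [move=> x; exact: is_derive_id|exact: Cdir_cst].
Qed.

Lemma C1_affine k (a b : R) : C1 k (fun t => a * t + b).
Proof.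
apply: Cdir_add; last exact: Cdir_cst.
by apply: Cdir_mul; [exact: Cdir_cst|exact: C1_id].
Qed.

Lemma C1_comp_affine k (f : R -> R) (a b : R) : C1 k f -> C1 k (fun t => f (a * t + b)).
Proof. by move=> Cf; exact: Cdir_comp Cf (C1_affine k a b). Qed.

(** The integral over [[0, x]] is 0 for all [x < a], negative [x] included since the interval is
    then empty, in agreement with [f = 0] there. The fundamental theorem is only called at points
    [x >= a > 0], inside an interval that starts at 0. *)
Lemma antiderivative (f : R -> R) (a : R) : continuous f -> 0 < a ->
  (forall x, x <= a -> f x = 0) -> exists F : R -> R, forall x : R, is_derive x 1 F (f x).
Proof.
move=> cf a0 f0.
exists (fun x => \int[lebesgue_measure]_(t in `[0, x]) f t) => x.
have [xa|ax] := ltP x a.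
  rewrite (f0 x (ltW xa)); apply: is_derive_near0.
  have : \forall y \near x, y < a by exact: lt_nbhsl.
  apply: filterS => y ya; rewrite /Rintegral integral0_eq// => t.
  by rewrite /= in_itv /= => /andP[_ ty]; rewrite f0// (le_trans ty)// ltW.
have x0 : 0 < x by exact: lt_le_trans a0 ax.
have xx : x < x + 1 by rewrite ltrDl.
have [|d1 d2] := continuous_FTC1_closed xx _ x0 (cf x).
  apply: continuous_compact_integrable; first exact: segment_compact.
  exact: continuous_subspaceT.
by split; [exact: d1|rewrite -derive1E].
Qed.

Definition step_den t := flat 0 (t - 1) + flat 0 (2 - t).

(** The usual smooth transition. The quotient is written as a power [-1] of a positive function so
    that [Cdir_mul_powR] yields smoothness. *)
Definition step t := flat 0 (t - 1) * step_den t `^ (- 1).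

Lemma flat_gt0 m t : 0 < t -> 0 < flat m t.
Proof. by move=> t0; rewrite /flat t0 mulr_gt0 ?expR_gt0// exprn_gt0// invr_gt0. Qed.

Lemma step_den_gt0 t : 0 < step_den t.
Proof.
have [t1|t1] := ltP 1 t; first by rewrite ltr_pwDl ?flat_ge0// flat_gt0// subr_gt0.
by rewrite ltr_wpDl ?flat_ge0// flat_gt0//; lra.
Qed.

Lemma C1_flat_affine k m (a b : R) : C1 k (fun t => flat m (a * t + b)).
Proof. exact/C1_comp_affine/C1_flat. Qed.

Lemma C1_flat_shift k m : C1 k (fun t => flat m (t - 1)).
Proof.
rewrite (_ : (fun t => _) = fun t => flat m (1 * t + (- 1))); first exact: C1_flat_affine.
by apply/funext => t; rewrite mul1r.
Qed.

Lemma C1_step_den k : C1 k step_den.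
Proof.
rewrite (_ : step_den =
    (fun t => flat 0 (1 * t + (- 1))) \+ (fun t => flat 0 ((-1) * t + 2))).
  by apply: Cdir_add; exact: C1_flat_affine.
by apply/funext => t; rewrite /step_den /= mul1r mulN1r [2 - t]addrC.
Qed.

Lemma C1_step k : C1 k step.
Proof.
apply: Cdir_mul_powR; [|exact: C1_step_den|by move=> x; left; exact: step_den_gt0].
exact: C1_flat_shift.
Qed.

Lemma step0 t : t <= 1 -> step t = 0.
Proof. by move=> t1; rewrite /step flat_le0 ?mul0r// subr_le0. Qed.

Lemma step1 t : 2 <= t -> step t = 1.
Proof.
move=> t2; have t0 : 0 < flat 0 (t - 1) by rewrite flat_gt0//; lra.
rewrite /step powR_inv1 ?(ltW (step_den_gt0 _))// /step_den
  (flat_le0 _ (t := 2 - t)) ?addr0 ?divff ?gt_eqF//.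
by rewrite subr_le0.
Qed.

Lemma step_ge0 t : 0 <= step t.
Proof. by rewrite mulr_ge0 ?flat_ge0 ?powR_ge0. Qed.

Section root.
Variable p : R.
Hypothesis p1 : 1 < p.
Let p10 : 0 < p - 1. Proof. by rewrite subr_gt0. Qed.
Let p1n : p - 1 != 0. Proof. by rewrite gt_eqF. Qed.

(** This is [step^(1/(p-1))]: the root of [exp(-1/(t-1))] is [flat 0] at the rescaled argument
    [(p-1)(t-1)], and the positive denominator may be raised to any power. The formula makes
    smoothness visible where [step] vanishes. *)
Definition step_root t := flat 0 ((p - 1) * (t - 1)) * step_den t `^ (- (p - 1)^-1).

Lemma C1_step_root k : C1 k step_root.
Proof.
apply: Cdir_mul_powR; [|exact: C1_step_den|by move=> x; left; exact: step_den_gt0].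
have := C1_flat_affine k 0 (p - 1) (- (p - 1)).
by under eq_fun do rewrite -[X in _ - X]mulr1 -mulrBr.
Qed.

Lemma step_rootE t : step_root t = step t `^ (p - 1)^-1.
Proof.
have d0 := step_den_gt0 t.
rewrite /step_root /step powRM ?flat_ge0 ?powR_ge0// -powRrM mulN1r; congr (_ * _).
rewrite /flat pmulr_rgt0// !expr0 !mul1r; case: ifPn => _; last first.
  by rewrite powR0// invr_eq0.
by rewrite /powR gt_eqF ?expR_gt0// expRK invfM mulrN.
Qed.

Lemma step_root_powR t : step_root t `^ (p - 1) = step t.
Proof. by rewrite step_rootE -powRrM mulVf// powRr1// step_ge0. Qed.

Lemma step_root_ge0 t : 0 <= step_root t.
Proof. by rewrite step_rootE powR_ge0. Qed.

Lemma step_root_gt0 t : 1 < t -> 0 < step_root t.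
Proof.
move=> t1; rewrite mulr_gt0 ?powR_gt0 ?step_den_gt0// flat_gt0// mulr_gt0//.
by rewrite subr_gt0.
Qed.

Lemma step_root0 t : t <= 1 -> step_root t = 0.
Proof. by move=> t1; rewrite step_rootE step0// powR0// invr_eq0. Qed.

Lemma step_root1 t : 2 <= t -> step_root t = 1.
Proof. by move=> t2; rewrite step_rootE step1// powR1. Qed.

End root.

(** Off [[1, 2]] the function [step] is locally constant; on that interval compactness bounds its
    continuous derivative. *)
Lemma derive_step_bounded : exists step' K, [/\
  forall t : R, is_derive t 1 step (step' t), forall t, `|step' t| <= K,
  forall t, t < 1 -> step' t = 0 &
  forall t, 2 < t -> step' t = 0].
Proof.
have [step' [dS cS]] := CdirP (k := 0) tt (C1_step 1).
have z1 t : t < 1 -> step' t = 0.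
  move=> t1; rewrite -(is_derive_val (dS t)).
  apply: derive_near0.
  have : \forall y \near t, y < 1 by exact: lt_nbhsl.
  by apply: filterS => y y1; rewrite step0// ltW.
have z2 t : 2 < t -> step' t = 0.
  move=> t2; rewrite -(is_derive_val (dS t)).
  have n1 : {near t, cst 1 =1 step}.
    have : \forall y \near t, 2 < y by exact: lt_nbhsr.
    by apply: filterS => y y1; rewrite step1// ltW.
  by rewrite -(near_eq_derive (1 : R) n1) derive_cst.
have cn : continuous (fun t => `|step' t|).
  by move=> x; apply: continuous_comp; [exact: cS|exact: norm_continuous].
have [c _ cm] := @EVT_max R (fun t => `|step' t|) 1 2 (ler_nat _ 1 2)
  (continuous_subspaceT cn).
exists step', `|step' c|; split => // t.
have [t1|t1] := ltP t 1; first by rewrite z1// normr0.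
have [t2|t2] := ltP 2 t; first by rewrite z2// normr0.
by apply: cm; rewrite in_itv /= t1.
Qed.

(* As [k] tends to infinity, [cutoff (k v) / k], which vanishes for [v <= 1/k],
   tends with its derivative to [v] for each [v > 0]. *)
Definition cutoff v := v * flat 0 (v - 1).

(** With [t = v - 1], the product rule gives [flat 0 t + (t + 1) flat 2 t], and
    [t flat 2 t = flat 1 t]. *)
Definition dcutoff v := flat 0 (v - 1) + flat 1 (v - 1) + flat 2 (v - 1).

Lemma C1_cutoff k : C1 k cutoff.
Proof.
apply: Cdir_mul; first exact: C1_id.
exact: C1_flat_shift.
Qed.

Lemma is_derive_cutoff v : is_derive v 1 cutoff (dcutoff v).
Proof.
have df : is_derive v 1 (fun v => flat 0 (v - 1)) (flat 2 (v - 1)).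
  have dB : is_derive v 1 (fun v : R => v - 1) 1.
    by have := is_deriveB (is_derive_id v (1 : R)) (is_derive_cst (1 : R) v 1);
      rewrite subr0.
  by have := @is_derive1_comp _ (flat 0) (fun v : R => v - 1) v _ _
    (is_derive_flat 0 (v - 1)) dB; rewrite mul0r subr0 mulr1.
have := is_deriveM (is_derive_id v (1 : R)) df; congr (is_derive _ _ _ _).
rewrite /GRing.scale /= /dcutoff -(flatSM 1 (v - 1)); ring.
Qed.

Lemma continuous_dcutoff : continuous dcutoff.
Proof.
have C := Cdir_add (Cdir_add (C1_flat_shift 0 0) (C1_flat_shift 0 1)) (C1_flat_shift 0 2).
exact: (Cdir_cont C).
Qed.

Lemma cutoff_neq0 v : cutoff v != 0 -> 1 < v.
Proof.
by apply: contraNT; rewrite -leNgt => v1; rewrite /cutoff flat_le0 ?mulr0// subr_le0.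
Qed.

(** The three terms are at most 1, 1 and 4 by [flat_le]; one more unit covers the subtracted 1. *)
Lemma dcutoff_bound v : `|dcutoff v - 1| <= 7.
Proof.
rewrite /dcutoff; move: (v - 1) => t.
have := flat_le 0 t; have := flat_le 1 t; have := flat_le 2 t.
have := flat_ge0 0 t; have := flat_ge0 1 t; have := flat_ge0 2 t.
by rewrite ler_norml expr0 expr1 expr2; lra.
Qed.

Lemma flat0_near1 t : 0 < t -> `|flat 0 t - 1| <= t^-1.
Proof.
move=> t0; have := flat_le 0 t; rewrite expr0 => f1.
rewrite distrC ger0_norm ?subr_ge0// /flat t0 expr0 mul1r.
by have := expR_ge1Dx (- t^-1); lra.
Qed.

(** With [t = v - 1], each of [|flat 0 t - 1|], [flat 1 t] and [flat 2 t] is at most [1/t]. *)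
Lemma dcutoff_near1 v : 1 < v -> `|dcutoff v - 1| <= 3 / (v - 1).
Proof.
rewrite /dcutoff -subr_gt0; move: (v - 1) => t t0.
have -> : flat 0 t + flat 1 t + flat 2 t - 1 =
  (flat 0 t - 1) + flat 1 t + flat 2 t by ring.
have fS m : flat m.+1 t = flat m t / t by rewrite -(flatSM m) mulfK ?gt_eqF.
have f1 : flat 1 t <= t^-1.
  by rewrite fS ler_piMl ?invr_ge0 ?(ltW t0)//; have := flat_le 0 t; rewrite expr0.
have f2 : flat 2 t <= t^-1.
  by rewrite (fS 1%N) ler_piMl ?invr_ge0 ?(ltW t0)//; have := flat_le 1 t; rewrite expr1.
have f0 := flat0_near1 t0; have g1 := flat_ge0 1 t; have g2 := flat_ge0 2 t.
apply: le_trans (ler_normD _ _) _; rewrite (ger0_norm g2).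
have := ler_normD (flat 0 t - 1) (flat 1 t); rewrite (ger0_norm g1); lra.
Qed.

End profile.

(** * Radial functions and the unit ball *)

Section radial.
Context {R : realType} {n : nat}.
Implicit Types (x y w : 'rV[R]_n) (i j : 'I_n) (k : nat).

Definition sqn x : R := dotr x x.

Lemma is_derive_coord x i j : is_derive x (basis i) (fun y => y 0 j) (i == j)%:R.
Proof.
have E : (fun t : R => (t *: basis i + x) 0 j) = (fun t => t * (i == j)%:R + x 0 j).
  by apply/funext => t; rewrite /basis !mxE eqxx eq_sym.
have [d1 d2] : is_derive (0 : R) 1 (fun t : R => t * (i == j)%:R + x 0 j) (i == j)%:R.
  have := is_deriveD (is_deriveM (is_derive_id (0 : R) (1 : R))
    (is_derive_cst ((i == j)%:R : R) (0 : R) 1)) (is_derive_cst (x 0 j) (0 : R) 1).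
  by rewrite scaler0 add0r addr0 /GRing.scale /= mulr1.
by split; [apply/derivable1P; rewrite E|rewrite derive_line E].
Qed.

Lemma Cdir_coord k j : Cdir (@basis R n) k (fun x => x 0 j).
Proof.
case: k => [|k]; first exact: coord_continuous.
apply: CdirS => [|i]; first exact: coord_continuous.
exists (cst (i == j)%:R); split; first by move=> x; exact: is_derive_coord.
exact: Cdir_cst.
Qed.

Lemma Cdir_sqn k : Cdir (@basis R n) k sqn.
Proof. by apply: Cdir_sum => j; apply: Cdir_mul; exact: Cdir_coord. Qed.

Lemma is_derive_sqn x i : is_derive x (basis i) sqn (2 * x 0 i).
Proof.
have := is_derive_sum (fun j =>
  is_deriveM (is_derive_coord x i j) (is_derive_coord x i j)).
congr (is_derive _ _ _ _).
  by apply/funext => y; rewrite fct_sumE.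
rewrite (bigD1 i)//= big1 ?addr0 => [|j /negbTE ji].
  by rewrite eqxx /GRing.scale /= mulr1 mulr2n mulrDl mul1r.
by rewrite eq_sym ji !scaler0 addr0.
Qed.

Lemma is_derive_radial (h : R -> R) (a : R) x i : is_derive (sqn x) 1 h a ->
  is_derive x (basis i) (h \o sqn) (a * (2 * x 0 i)).
Proof. by move=> dh; apply: is_derive_comp_dir => //; exact: is_derive_sqn. Qed.

Lemma sqn_ge0 x : 0 <= sqn x.
Proof. by apply: sumr_ge0 => i _; rewrite -expr2 sqr_ge0. Qed.

Lemma unit_ballE x : unit_ball n x = (sqn x < 1) :> Prop.
Proof.
rewrite /unit_ball /= /enorm -/(sqn x) -{1}(@sqrtr1 R).
by rewrite ltr_sqrt.
Qed.

Lemma sqr_coord_le_sqn x i : x 0 i ^+ 2 <= sqn x.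
Proof.
rewrite /sqn /dotr (bigD1 i)//= -expr2 lerDl.
by apply: sumr_ge0 => j _; rewrite -expr2 sqr_ge0.
Qed.

Lemma sqn_le_cube x (c : R) : 0 <= c -> sqn x <= c ^+ 2 -> cube c x.
Proof.
move=> c0 xc i; rewrite in_itv /= -ler_norml -(ger0_norm c0) -ler_sqr ?nnegrE//.
by rewrite !real_normK ?num_real// (le_trans (sqr_coord_le_sqn x i)).
Qed.

Lemma unit_ball_cube : unit_ball n `<=` cube (1 : R).
Proof.
by move=> x; rewrite unit_ballE => x1; apply: sqn_le_cube => //; rewrite expr1n ltW.
Qed.

Lemma continuous_sqn : continuous sqn.
Proof. exact: Cdir_cont (Cdir_sqn 0). Qed.

Lemma measurable_unit_ball : measurable (@unit_ball R n).
Proof.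
rewrite (_ : unit_ball n = sqn @^-1` `]-oo, 1[%classic).
  rewrite -[X in measurable X]setTI.
  exact: (continuous_measurable_rV continuous_sqn).
by apply/seteqP; split=> x; rewrite /= in_itv /= unit_ballE.
Qed.

Lemma unit_ball_nonnegligible :
  ~ {ae lebesgue_rV n, forall x : 'rV[R]_n, ~ unit_ball n x}.
Proof.
move=> [A [mA A0 Asub]].
(* The cube of half-side [c] lies in the ball because [n c^2 = n/(n+1)^2 < 1], and it has positive
   measure. *)
pose c : R := n.+1%:R^-1.
have c0 : 0 < c by rewrite invr_gt0.
have cA : cube c `<=` A.
  move=> x xc; apply: Asub => /= nx; apply: nx; rewrite unit_ballE.
  apply: (@le_lt_trans _ _ (\sum_(i < n) c ^+ 2)).
    apply: ler_sum => i _; rewrite -expr2 -[leLHS]real_normK ?num_real//.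
    rewrite lerXn2r ?nnegrE ?(ltW c0)//.
    by have := xc i; rewrite in_itv /= ler_norml.
  rewrite sumr_const card_ord -mulr_natl /c exprVn -ltr_pdivlMr ?invr_gt0 ?exprn_gt0//.
  by rewrite invrK mul1r -natrX ltr_nat -mulnn mulSn leq_addr.
have : (lebesgue_rV n (cube c) <= lebesgue_rV n A)%E.
  by apply: le_measure; rewrite ?inE //; exact: measurable_cube.
rewrite A0 lebesgue_cube// lee_fin leNgt => /negP; apply.
by rewrite exprn_gt0// mulrn_wgt0.
Qed.

Lemma dotrZl (a : R) x w : dotr (a *: x) w = a * dotr x w.
Proof. by rewrite /dotr mulr_sumr; apply: eq_bigr => i _; rewrite mxE mulrA. Qed.

Lemma enormZ (a : R) x : enorm (a *: x) = `|a| * Num.sqrt (sqn x).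
Proof.
rewrite /enorm dotrZl /dotr; under eq_bigr do rewrite mxE mulrCA.
by rewrite -mulr_sumr mulrA -expr2 sqrtrM ?sqr_ge0// sqrtr_sqr.
Qed.

End radial.

(** * The solution and its potential *)

Lemma ler_powRN {R : realType} (e a b : R) : 0 <= e -> 0 < a -> a <= b ->
  b `^ (- e) <= a `^ (- e).
Proof.
move=> e0 a0 ab; have b0 : 0 < b by exact: lt_le_trans ab.
rewrite !powRN lef_pV2 ?posrE ?powR_gt0// ge0_ler_powR ?nnegrE//; exact: ltW.
Qed.

Section construction.
Context {R : realType} {n : nat}.
Variables (p E : R).
Hypotheses (p1 : 1 < p) (pn : p < n%:R) (E0 : 0 < E) (E4 : 4 * E <= 1).
Implicit Types (s t a b : R) (x y : 'rV[R]_n) (k : nat).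

(** The p-harmonic [|x|^(-(n-p)/(p-1))] is [s^(-decay)] in the variable [s = |x|^2]; hence the extra
    2. *)
Definition decay : R := (n%:R - p) / (2 * (p - 1)).

Lemma decay_ge0 : 0 <= decay.
Proof. by rewrite divr_ge0 ?mulr_ge0 ?subr_ge0 ?(ltW p1) ?(ltW pn)//; lra. Qed.

Lemma E_lt1 : E < 1.
Proof. by have := E0; have := E4; lra. Qed.

Lemma div_le1 s : s <= E -> s / E <= 1.
Proof. by rewrite ler_pdivrMr// mul1r. Qed.

(* With [s = |x|^2] the gradient of [ground] is [- slope s *: x].  The power of
   [s] makes the p-flux [|grad u|^(p-2) grad u] proportional to [x / |x|^n],
   hence divergence free, where [step_root] is constant. *)
Definition slope s : R := step_root p (s / E) * s `^ (- decay - 1).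

Lemma C1_comp_div k (f : R -> R) : C1 k f -> C1 k (fun s => f (s / E)).
Proof.
move=> /(C1_comp_affine E^-1 0).
rewrite (_ : (fun t => _) = fun s => f (s / E))//.
by apply/funext => s; rewrite addr0 mulrC.
Qed.

(** The dichotomy required by [Cdir_mul_powR]: powers of [s] are smooth for [s > 0], and below [E]
    the factors [step(s/E)] and [step_root(s/E)] vanish. *)
Lemma near_lt_or_pos s : 0 < s \/ \forall t \near s, t < E.
Proof.
by have [|s0] := ltP 0 s; [left|right; apply: lt_nbhsl; exact: le_lt_trans E0].
Qed.

Lemma C1_slope k : C1 k slope.
Proof.
apply: Cdir_mul_powR; [exact/C1_comp_div/C1_step_root|exact: C1_id|].
move=> s; have [s0|sE] := near_lt_or_pos s; [by left|right].
by apply: filterS sE => t /ltW/div_le1 tE; rewrite step_root0.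
Qed.

Lemma slope_ge0 s : 0 <= slope s.
Proof. by rewrite mulr_ge0 ?step_root_ge0 ?powR_ge0. Qed.

Lemma slope_eq0 s : s <= E -> slope s = 0.
Proof. by move=> /div_le1 sE; rewrite /slope step_root0 ?mul0r. Qed.

Lemma slope_gt0 s : E < s -> 0 < slope s.
Proof.
move=> sE; have s0 : 0 < s by exact: lt_trans sE.
by rewrite mulr_gt0 ?powR_gt0// step_root_gt0// ltr_pdivlMr// mul1r.
Qed.

(** The factor [2^-1] in its derivative cancels the 2 in [grad |x|^2 = 2 x]. *)
Variable P : R -> R.
Hypothesis dP : forall s : R, is_derive s 1 P (2^-1 * slope s).

Lemma C1_primitive k : C1 k P.
Proof.
have cP : continuous P by move=> s; exact: is_derive1_continuous (dP s).
case: k => [|k]; first exact: cP.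
apply: CdirS => // _; exists (fun s => 2^-1 * slope s); split => //.
by apply: Cdir_mul; [exact: Cdir_cst|exact: C1_slope].
Qed.

Lemma primitive_MVT a b : a < b ->
  exists2 c, a < c < b & P b - P a = 2^-1 * slope c * (b - a).
Proof.
move=> ab; have [|c cab H] := @MVT _ P _ a b ab (fun t _ => dP t).
  exact: continuous_subspaceT (Cdir_cont (C1_primitive 0)).
by exists c => //; move: cab; rewrite in_itv.
Qed.

Lemma primitive_le a b : a <= b -> P a <= P b.
Proof.
rewrite le_eqVlt => /predU1P[->//|ab]; have [c _ H] := primitive_MVT ab.
rewrite -subr_ge0 H; apply: mulr_ge0; last by rewrite subr_ge0 ltW.
by apply: mulr_ge0; [rewrite invr_ge0|exact: slope_ge0].
Qed.

Lemma primitive_lt a b : a < b -> E < b -> P a < P b.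
Proof.
(* [P] is constant below [E], so strict growth is sought only from the larger of [a] and [E]. *)
move=> ab Eb; apply: (@le_lt_trans _ _ (P (Num.max a E))).
  by apply: primitive_le; rewrite le_max lexx.
have mb : Num.max a E < b by rewrite gt_max ab.
have [c /andP[mc cb] H] := primitive_MVT mb.
rewrite -subr_gt0 H; apply: mulr_gt0; last by rewrite subr_gt0.
apply: mulr_gt0; [by rewrite invr_gt0|apply: slope_gt0].
by apply: le_lt_trans mc; rewrite le_max lexx orbT.
Qed.

(** The formula is kept outside the ball, where it is negative, rather than cut to 0: this keeps the
    function smooth on the whole space, and [cutoff] removes the negative values from the
    approximants. *)
Definition ground x : R := P 1 - P (sqn x).
Definition ground_grad x : 'rV[R]_n := (- slope (sqn x)) *: x.
Local Notation u := ground.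
Local Notation G := ground_grad.

Lemma ground_gt0 x : (0 < u x) = (sqn x < 1).
Proof.
apply/idP/idP; rewrite subr_gt0.
  by apply: contraTT; rewrite -!leNgt; exact: primitive_le.
by move=> x1; apply: primitive_lt => //; exact: E_lt1.
Qed.

(** The value at [x] is at least the drop [P(4E) - P(2E)], because [4E <= 1]. Between [2E] and [4E]
    the slope is the pure power [s^(-decay-1)], smallest at [4E], and the mean value theorem bounds
    the drop. *)
Lemma ground_ge x : sqn x <= 2 * E -> E * (4 * E) `^ (- decay - 1) <= u x.
Proof.
move=> x2E.
have [|c /andP[c2 c4] H] := @primitive_MVT (2 * E) (4 * E).
  by rewrite ltr_pM2r ?ltr_nat.
have P1 : P (4 * E) <= P 1 by exact: primitive_le.
have P2 : P (sqn x) <= P (2 * E) by exact: primitive_le.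
suff : E * (4 * E) `^ (- decay - 1) <= P (4 * E) - P (2 * E) by rewrite /u; lra.
have c0 : 0 < c by apply: lt_trans c2; rewrite mulr_gt0.
rewrite H /slope step_root1 ?mul1r//; last by rewrite ler_pdivlMr// ltW.
have -> : 2^-1 * c `^ (- decay - 1) * (4 * E - 2 * E) = E * c `^ (- decay - 1) by field.
rewrite ler_pM2l// -opprD; apply: ler_powRN => //; last exact: ltW.
by rewrite addr_ge0// decay_ge0.
Qed.

Lemma is_derive_ground x i : is_derive x (basis i) u (G x 0 i).
Proof.
have dN := is_deriveB (is_derive_cst (P 1) x (basis i)) (is_derive_radial i (dP (sqn x))).
have := dN; congr (is_derive _ _ _ _).
by rewrite /G !mxE sub0r; field.
Qed.

Lemma Cdir_ground k : Cdir (@basis R n) k u.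
Proof.
rewrite (_ : u = (fun s => (-1) * P s + P 1) \o (@sqn R n)); last first.
  by apply/funext => x; rewrite /= mulN1r addrC.
apply: Cdir_comp; last exact: Cdir_sqn.
apply: Cdir_add; last exact: Cdir_cst.
by apply: Cdir_mul; [exact: Cdir_cst|exact: C1_primitive].
Qed.

Lemma continuous_ground : continuous u.
Proof. exact: Cdir_cont (Cdir_ground 0). Qed.

Lemma Cdir_radial_coord k (h : R -> R) i : C1 k h ->
  Cdir (@basis R n) k (fun x => h (sqn x) * x 0 i).
Proof.
by move=> Ch; apply: Cdir_mul; [exact: Cdir_comp Ch (Cdir_sqn k)|exact: Cdir_coord].
Qed.

Lemma continuous_ground_grad i : continuous (fun x => G x 0 i).
Proof.
rewrite (_ : (fun x => _) = fun x => (-1 * slope (sqn x)) * x 0 i); last first.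
  by apply/funext => x; rewrite /G mxE mulN1r.
apply: (@Cdir_cont _ _ _ (@basis R n) 0).
apply: (Cdir_radial_coord (h := fun s => -1 * slope s)).
exact: (Cdir_mul (Cdir_cst _ 0 (-1)) (C1_slope 0)).
Qed.

(** * Membership in [W_0^{1,p}] of the ball *)

Lemma continuous_bounded_ball (f : 'rV[R]_n -> R) : continuous f ->
  exists C, forall x, unit_ball n x -> `|f x| <= C.
Proof.
by move=> /(continuous_bounded_cube 1)[C fC]; exists C => x /unit_ball_cube/fC.
Qed.

Lemma measurable_on_ball (f : 'rV[R]_n -> R) : measurable_fun setT f ->
  measurable_fun (unit_ball n) f.
Proof. exact: (measurable_funS measurableT (@subsetT _ _)). Qed.

Lemma continuous_LpD (f : 'rV[R]_n -> R) : continuous f -> LpD (unit_ball n) p f.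
Proof.
move=> cf; have [C fC] := continuous_bounded_ball cf.
apply: (bounded_LpD measurable_unit_ball (@unit_ball_cube _ _) (ltW p1) _ fC).
exact: measurable_on_ball (continuous_measurable_rV cf).
Qed.

Lemma sobolev_ground : sobolev (unit_ball n) p u G.
Proof.
split; first exact: (continuous_LpD continuous_ground).
- by move=> i; exact: (continuous_LpD (@continuous_ground_grad i)).
- move=> psi i tpsi; have [spsi _ _] := tpsi.
  rewrite [LHS]Rintegral_outside0; last first.
    by move=> x Dx; rewrite (test_fun_partial_out _ tpsi Dx) mulr0.
  rewrite [X in - X]Rintegral_outside0; last first.
    by move=> x Dx; rewrite (nbhs_singleton (test_fun_near0 tpsi Dx)) mulr0.
  apply: Rintegral_by_parts_rV.
  + exact: continuous_ground_grad.
  + exact: continuous_ground.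
  + by move=> x; exact: is_derive_ground.
  + exact: spsi.
  + exact: test_fun_bounded_support tpsi.
Qed.

Definition ground_approx k x : R := k.+1%:R^-1 * cutoff (k.+1%:R * u x).
Local Notation phi := ground_approx.

Lemma is_derive_ground_approx k x i :
  is_derive x (basis i) (phi k) (dcutoff (k.+1%:R * u x) * G x 0 i).
Proof.
have k0 : k.+1%:R != 0 :> R by rewrite pnatr_eq0.
have d1 : is_derive x (basis i) (fun y => k.+1%:R * u y) (k.+1%:R * G x 0 i).
  by have := is_deriveM (is_derive_cst (k.+1%:R : R) x (basis i)) (is_derive_ground x i);
    rewrite scaler0 addr0.
have d2 := @is_derive_comp_dir _ _ (fun y => k.+1%:R * u y) cutoff x _ _ _
  (is_derive_cutoff (k.+1%:R * u x)) d1.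
have := is_deriveM (is_derive_cst (k.+1%:R^-1 : R) x (basis i)) d2.
congr (is_derive _ _ _ _); rewrite scaler0 addr0 /GRing.scale /= /cst.
by rewrite [LHS]mulrCA mulKf.
Qed.

(** The support lies in the closed set [u >= 1/(k+1)]. As [u] is positive exactly in the open ball,
    this set stays inside the ball and is compact. *)
Lemma test_fun_ground_approx k : test_fun (unit_ball n) (phi k).
Proof.
have k0 : 0 < k.+1%:R :> R by rewrite ltr0n.
have sm j : Cdir (@basis R n) j (phi k).
  apply: Cdir_mul; first exact: Cdir_cst.
  apply: (Cdir_comp (f := fun x => k.+1%:R * u x)); first exact: C1_cutoff.
  by apply: Cdir_mul; [exact: Cdir_cst|exact: Cdir_ground].
have cD : closure [set x | phi k x != 0] `<=` unit_ball n.
  have cu : closed [set x | k.+1%:R^-1 <= u x].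
    rewrite (_ : [set x | _] = u @^-1` `[k.+1%:R^-1, +oo[%classic).
      apply: closed_comp; last exact: interval_closed.
      by move=> x _; exact: continuous_ground.
    by apply/seteqP; split => x; rewrite /= in_itv /= andbT.
  apply: (@subset_trans _ [set x | k.+1%:R^-1 <= u x]).
    rewrite [X in _ `<=` X]((closure_id _).1 cu); apply: closure_subset => x /= phix.
    have /cutoff_neq0 : cutoff (k.+1%:R * u x) != 0.
      by apply: contra phix => /eqP H; rewrite /phi H mulr0.
    by rewrite -ltr_pdivrMl// mulr1 => /ltW.
  by move=> x /= ux; rewrite unit_ballE -ground_gt0 (lt_le_trans _ ux)// invr_gt0.
split => //.
apply: (@subclosed_compact _ _ (cube 1)); first exact: closed_closure.
  exact: compact_cube.
exact: subset_trans cD (@unit_ball_cube _ _).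
Qed.

Lemma near_ltn_mul (B c : R) : 0 < c -> \forall k \near \oo, B < k.+1%:R * c.
Proof.
move=> c0; have : \forall k \near \oo, (B / c < k%:R)%R by exact: nbhs_infty_gtr.
apply: filterS => k; rewrite ltr_pdivrMr// => /lt_trans; apply.
by rewrite ltr_pM2r// ltr_nat.
Qed.

Lemma cvg0_mul_bound (c C : R) (f : nat -> R) : 0 < c -> 0 <= C ->
  (forall k, 1 < k.+1%:R * c -> `|f k| <= 3 / (k.+1%:R * c - 1) * C) ->
  f @ \oo --> (0 : R).
Proof.
move=> c0 C0 fC; apply/cvgr0Pnorm_lt => e e0.
have := near_ltn_mul (3 * C / e + 1) c0; apply: filterS => k kB.
have CE : 0 <= 3 * C / e by rewrite divr_ge0 ?mulr_ge0// ltW.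
have k1 : 1 < k.+1%:R * c by apply: le_lt_trans kB; rewrite lerDr.
apply: le_lt_trans (fC k k1) _; rewrite mulrAC ltr_pdivrMr ?subr_gt0//.
by rewrite -ltr_pdivrMl// mulrC ltrBrDr.
Qed.

(** With [k] short for [k.+1], both errors factor: [phi - u] is [u (flat 0 (k u - 1) - 1)], and the
    gradient error is [(dcutoff (k u) - 1) G]. The scalar factors are bounded by 1 and 7, and tend
    to 0 at every point of the ball since [u > 0] there makes [k u] tend to infinity. *)
Lemma sobolev0_ground : sobolev0 (unit_ball n) p u G.
Proof.
split; first exact: sobolev_ground.
have cu : continuous u := continuous_ground.
have [Cu uC] := continuous_bounded_ball cu.
have cG : continuous (fun x => enorm (G x)).
  rewrite (_ : (fun x => _) = fun x => slope (sqn x) * Num.sqrt (sqn x)); last first.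
    by apply/funext => x; rewrite enormZ normrN ger0_norm ?slope_ge0.
  apply: continuous_mul; last first.
    exact: (@continuous_compose _ _ _ Num.sqrt sqn (@sqrt_continuous R) continuous_sqn).
  exact: (@continuous_compose _ _ _ slope sqn (Cdir_cont (C1_slope 0)) continuous_sqn).
have [CG GC] := continuous_bounded_ball cG.
have gradE k x : grad (phi k) x - G x = (dcutoff (k.+1%:R * u x) - 1) *: G x.
  apply/rowP => i; rewrite !mxE (partialE (is_derive_ground_approx k ^~ i)).
  by rewrite /G !mxE mulrBl mul1r.
have eE k x : enorm (grad (phi k) x - G x) =
    `|dcutoff (k.+1%:R * u x) - 1| * enorm (G x).
  by rewrite gradE /enorm -/(enorm _) enormZ.
have c1 k : continuous (fun x => phi k x - u x).
  have [sm _ _] := test_fun_ground_approx k.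
  by move=> x; apply: continuousB; [exact: (sm 0%N)|exact: cu].
have phiE k x : phi k x - u x = u x * (flat 0 (k.+1%:R * u x - 1) - 1).
  by rewrite [RHS]mulrBr mulr1 /phi /cutoff -mulrA mulKf ?pnatr_eq0.
have fb t : `|flat 0 t - 1| <= 1.
  have := flat_le 0 t; have := flat_ge0 0 t; rewrite expr0 ler_norml; lra.
exists phi; split; first exact: test_fun_ground_approx.
- apply: (LnormD_cvg0 measurable_unit_ball (@unit_ball_cube _ _) (C := Cu) (ltW p1)).
  + by move=> k; exact: measurable_on_ball (continuous_measurable_rV (c1 k)).
  + move=> k x Dx; rewrite phiE normrM; apply: le_trans (uC x Dx).
    by rewrite ler_piMr.
  + move=> x; rewrite unit_ballE -ground_gt0 => ux.
    apply: (cvg0_mul_bound (C := u x) ux (ltW ux)) => k k1.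
    rewrite phiE normrM (gtr0_norm ux) mulrC ler_pM2r//.
    have k10 : 0 < k.+1%:R * u x - 1 by rewrite subr_gt0.
    apply: le_trans (flat0_near1 k10) _.
    by rewrite ler_peMl ?invr_ge0 ?(ltW k10)// ler1n.
- apply: (LnormD_cvg0 measurable_unit_ball (@unit_ball_cube _ _) (C := 7 * CG) (ltW p1)).
  + move=> k; rewrite (_ : (fun x => _) = fun x =>
        `|dcutoff (k.+1%:R * u x) - 1| * enorm (G x)); last by apply/funext.
    apply: measurable_on_ball; apply: continuous_measurable_rV.
    apply: continuous_mul cG; apply: (continuous_compose norm_continuous).
    apply: (@continuous_add _ _ (fun x => dcutoff (k.+1%:R * u x)) (cst (- 1))).
      apply: (continuous_compose continuous_dcutoff).
      by apply: continuous_mul cu; exact: cst_continuous.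
    exact: cst_continuous.
  + move=> k x Dx; rewrite eE normrM normr_id; apply: ler_pM => //.
      exact: dcutoff_bound.
    exact: GC.
  + move=> x; rewrite unit_ballE -ground_gt0 => ux.
    apply: (cvg0_mul_bound (C := enorm (G x)) ux (sqrtr_ge0 _)) => k k1.
    rewrite eE normrM normr_id (ger0_norm (sqrtr_ge0 _)).
    by rewrite ler_wpM2r ?sqrtr_ge0// dcutoff_near1.
Qed.

(* The p-flux of [ground] is [- flux (|x|^2) *: x] by [ground_flux], and
   [source] below is minus its divergence. *)
Definition flux s : R := step (s / E) * s `^ (- (n%:R / 2)).

(** For [s > E] the exponent of [s] is [-(decay+1)(p-1) + (p-2)/2 = -n/2]. For [s <= E] both sides
    vanish, whatever the value of [0^(p-2)], thanks to the last factor [slope s]. *)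
Lemma flux_slope s : 0 <= s ->
  (slope s * Num.sqrt s) `^ (p - 2) * slope s = flux s.
Proof.
move=> s0; have [sE|sE] := leP s E.
  by rewrite slope_eq0// mulr0 /flux step0 ?mul0r ?div_le1.
have sp : 0 < s by exact: lt_trans sE.
have q0 := slope_gt0 sE.
rewrite -powR12_sqrt// powRM ?powR_ge0 ?(ltW q0)// mulrAC.
have -> : slope s `^ (p - 2) * slope s = slope s `^ (p - 1).
  rewrite -[X in _ * X](powRr1 (ltW q0)) -powRD; last by rewrite (gt_eqF q0) implybT.
  by congr (_ `^ _); ring.
rewrite /slope powRM ?step_root_ge0 ?powR_ge0// step_root_powR// -!powRrM /flux -mulrA.
rewrite -powRD; last by rewrite (gt_eqF sp) implybT.
congr (_ * _ `^ _); rewrite /decay; field.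
by rewrite subr_eq0 gt_eqF.
Qed.

Lemma ground_flux x w :
  enorm (G x) `^ (p - 2) * dotr (G x) w = - (flux (sqn x) * dotr x w).
Proof.
rewrite enormZ normrN (ger0_norm (slope_ge0 _)) dotrZl mulrA mulrN mulNr.
by rewrite flux_slope ?sqn_ge0.
Qed.

(** * Divergence of the flux and the equation *)

Variables (step' : R -> R) (K : R).
Hypothesis dstep : forall t : R, is_derive t 1 step (step' t).
Hypothesis stepK : forall t, `|step' t| <= K.
Hypothesis step'_lt1 : forall t, t < 1 -> step' t = 0.
Hypothesis step'_gt2 : forall t, 2 < t -> step' t = 0.

Definition dflux s : R := step' (s / E) / E * s `^ (- (n%:R / 2)) +
  step (s / E) * (- (n%:R / 2) * s `^ (- (n%:R / 2) - 1)).

Lemma C1_flux k : C1 k flux.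
Proof.
apply: Cdir_mul_powR; [exact/C1_comp_div/C1_step|exact: C1_id|].
move=> s; have [s0|sE] := near_lt_or_pos s; [by left|right].
by apply: filterS sE => t /ltW/div_le1 tE; rewrite step0.
Qed.

Lemma is_derive_flux s : is_derive s 1 flux (dflux s).
Proof.
have [s0|sE] := near_lt_or_pos s.
  have dd : is_derive s 1 (fun s => s / E) E^-1.
    have := is_deriveM (is_derive_id s (1 : R)) (is_derive_cst E^-1 s 1).
    by rewrite scaler0 add0r /GRing.scale /= mulr1.
  have d1 := @is_derive1_comp _ step (fun s => s / E) s _ _ (dstep (s / E)) dd.
  have := is_deriveM d1 (is_derive1_powR (- (n%:R / 2)) s0).
  congr (is_derive _ _ _ _); rewrite /GRing.scale /= /dflux; ring.
have sE1 := nbhs_singleton sE.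
have -> : dflux s = 0.
  rewrite /dflux step'_lt1 ?step0 ?mul0r ?addr0 ?div_le1 ?(ltW sE1)//.
  by rewrite ltr_pdivrMr// mul1r.
apply: is_derive_near0; apply: filterS sE => t tE.
by rewrite /flux step0 ?mul0r// div_le1// ltW.
Qed.

(** By uniqueness of the derivative this follows from [C1_flux], which has already dealt with the
    singular powers at 0. *)
Lemma continuous_dflux : continuous dflux.
Proof.
have [g [dg cg]] := CdirP (k := 0) tt (C1_flux 1).
rewrite (_ : dflux = g)//; apply/funext => s.
by rewrite -(is_derive_val (dg s)) (is_derive_val (is_derive_flux s)).
Qed.

Definition source s : R := n%:R * flux s + 2 * s * dflux s.

(** The field [x/|x|^n] is divergence free off the origin, so the two terms without [step'] cancel:
    [n s^(-n/2) + 2 s (-n/2) s^(-n/2-1) = 0]. What remains is carried by the shell where [step(s/E)]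
    varies. *)
Lemma sourceE s : source s = 2 * s * (step' (s / E) / E) * s `^ (- (n%:R / 2)).
Proof.
rewrite /source /flux /dflux; have [s0|s0] := ltP 0 s; last first.
  rewrite step0 ?step'_lt1 ?mul0r ?addr0 ?mulr0 ?mul0r ?addr0//.
    by rewrite ltr_pdivrMr// mul1r (le_lt_trans s0).
  by rewrite div_le1// (le_trans s0)// ltW.
have -> : s `^ (- (n%:R / 2) - 1) = s `^ (- (n%:R / 2)) / s.
  by rewrite powRD ?(gt_eqF s0) ?implybT// powR_inv1// ltW.
by field; rewrite !gt_eqF.
Qed.

Lemma continuous_source : continuous (fun x => source (sqn x)).
Proof.
apply: continuous_add; apply: continuous_mul.
- exact: cst_continuous.
- exact: (@continuous_compose _ _ _ flux sqn (Cdir_cont (C1_flux 0)) continuous_sqn).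
- by apply: continuous_mul; [exact: cst_continuous|exact: continuous_sqn].
- exact: (@continuous_compose _ _ _ dflux sqn continuous_dflux continuous_sqn).
Qed.

Definition potential x : R := source (sqn x) * u x `^ (1 - p).
Local Notation V := potential.

Lemma potentialE x : unit_ball n x -> V x * (`|u x| `^ (p - 2) * u x) = source (sqn x).
Proof.
rewrite unit_ballE -ground_gt0 => ux; rewrite /potential gtr0_norm//.
rewrite -mulrA -[X in _ * (_ * (_ * X))](powRr1 (ltW ux)).
rewrite -!powRD ?(gt_eqF ux) ?implybT//.
by rewrite (_ : 1 - p + (p - 2 + 1) = 0) ?powRr0 ?mulr1//; ring.
Qed.

Lemma integrable_sum_rV (r : seq 'I_n) (F : 'I_n -> 'rV[R]_n -> R) :
  (forall i, (lebesgue_rV n).-integrable setT (EFin \o F i)) ->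
  (lebesgue_rV n).-integrable setT (EFin \o (fun x => \sum_(i <- r) F i x)).
Proof.
move=> iF; rewrite (_ : _ \o _ = fun x => (\sum_(i <- r) (EFin \o F i) x)%E); last first.
  by apply/funext => x; rewrite /= sumEFin.
by apply: integrable_sum.
Qed.

Lemma Rintegral_sum_rV (F : 'I_n -> 'rV[R]_n -> R) :
  (forall i, (lebesgue_rV n).-integrable setT (EFin \o F i)) ->
  \int[lebesgue_rV n]_x (\sum_i F i x) = \sum_i \int[lebesgue_rV n]_x F i x.
Proof.
move=> iF; elim: (index_enum _) => [|i r IH].
  rewrite big_nil; under eq_Rintegral do rewrite big_nil.
  by rewrite Rintegral_cst// mul0r.
rewrite big_cons -IH -RintegralD//; last exact: integrable_sum_rV.
by under eq_Rintegral do rewrite big_cons.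
Qed.

(** Each component [flux(|x|^2) x_i] is integrated by parts against [psi]; the derivatives [F' i]
    add up to [source], which on the ball is [V |u|^(p-2) u] by [potentialE]. *)
Lemma solution_ground : p_laplace_solution (unit_ball n) p V u G.
Proof.
move=> psi tpsi lhs rhs; have [spsi _ _] := tpsi.
have bpsi := test_fun_bounded_support tpsi.
have cpsi : continuous psi := spsi 0%N.
have cpart i : continuous (partial i psi) := Ck_continuous (Ck_partial i (spsi 1%N)).
have cF i : continuous (fun x => flux (sqn x) * x 0 i).
  exact: Cdir_cont (Cdir_radial_coord i (C1_flux 0)).
pose F' (i : 'I_n) x := dflux (sqn x) * (2 * x 0 i) * x 0 i + flux (sqn x).
have dF i x : is_derive x (basis i) (fun x => flux (sqn x) * x 0 i) (F' i x).
  have := is_deriveM (is_derive_radial i (is_derive_flux (sqn x))) (is_derive_coord x i i).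
  congr (is_derive _ _ _ _); rewrite eqxx /GRing.scale /= /F'; ring.
have cF' i : continuous (F' i).
  apply: continuous_add; last first.
    exact: (@continuous_compose _ _ _ flux sqn (Cdir_cont (C1_flux 0)) continuous_sqn).
  apply: continuous_mul; last exact: coord_continuous.
  apply: continuous_mul.
    exact: (@continuous_compose _ _ _ dflux sqn continuous_dflux continuous_sqn).
  by apply: continuous_mul; [exact: cst_continuous|exact: coord_continuous].
have iFpart i : (lebesgue_rV n).-integrable setT
    (EFin \o (fun x => flux (sqn x) * x 0 i * partial i psi x)).
  apply: continuous_integrable; first exact: continuous_mul.
  exact/bounded_support_mull/bounded_support_derive.
have iNFpart i : (lebesgue_rV n).-integrable setT
    (EFin \o (fun x => (-1) * (flux (sqn x) * x 0 i * partial i psi x))).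
  by apply: (integrableZl measurableT _ (iFpart i)).
have iF'psi i : (lebesgue_rV n).-integrable setT (EFin \o (fun x => F' i x * psi x)).
  by apply: continuous_integrable; [exact: continuous_mul|exact: bounded_support_mull].
have isrc : (lebesgue_rV n).-integrable setT (EFin \o (fun x => source (sqn x) * psi x)).
  apply: continuous_integrable; last exact: bounded_support_mull.
  exact: continuous_mul continuous_source cpsi.
have lhsE x : lhs x = - \sum_i flux (sqn x) * x 0 i * partial i psi x.
  rewrite /lhs ground_flux /dotr mulr_sumr; congr (- _); apply: eq_bigr => i _.
  by rewrite mxE mulrA.
have srcE x : source (sqn x) * psi x = \sum_i F' i x * psi x.
  rewrite -mulr_suml; congr (_ * _); rewrite /F' big_split /= sumr_const card_ord.
  rewrite /source addrC mulr_natl; congr (_ + _).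
  rewrite -[X in 2 * X]/(dotr x x) /dotr mulr_sumr mulr_suml.
  by apply: eq_bigr => i _; ring.
have rhsE x : unit_ball n x -> rhs x = source (sqn x) * psi x.
  by move=> Dx; rewrite /rhs potentialE.
have ilhs : (lebesgue_rV n).-integrable setT (EFin \o lhs).
  rewrite (_ : lhs = fun x =>
    \sum_i (-1) * (flux (sqn x) * x 0 i * partial i psi x)); last first.
    by apply/funext => x; rewrite lhsE -mulr_sumr mulN1r.
  exact: integrable_sum_rV.
split.
- exact: (integrableS measurableT measurable_unit_ball (@subsetT _ _) ilhs).
- apply: (@eq_integrable _ _ _ _ _ measurable_unit_ball
    (EFin \o (fun x => source (sqn x) * psi x))).
    by move=> x; rewrite inE => Dx; rewrite /= rhsE.
  exact: (integrableS measurableT measurable_unit_ball (@subsetT _ _) isrc).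
- rewrite [RHS](@eq_Rintegral _ _ _ _ _ (fun x => source (sqn x) * psi x)); last first.
    by move=> x; rewrite inE => /rhsE.
  rewrite [LHS]Rintegral_outside0; last first.
    move=> x Dx; rewrite lhsE big1 ?oppr0// => i _.
    by rewrite (test_fun_partial_out _ tpsi Dx) mulr0.
  rewrite [RHS]Rintegral_outside0; last first.
    by move=> x Dx; rewrite (nbhs_singleton (test_fun_near0 tpsi Dx)) mulr0.
  under eq_Rintegral do rewrite lhsE -mulN1r mulr_sumr.
  under [RHS]eq_Rintegral do rewrite srcE.
  rewrite !Rintegral_sum_rV//; apply: eq_bigr => i _.
  rewrite RintegralZl// mulN1r.
  by rewrite (Rintegral_by_parts_rV (cF' i) (cF i) (dF i) (spsi 1%N) bpsi) opprK.
Qed.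

(** * Size of the potential *)

Lemma potential_out x : 2 * E < sqn x -> V x = 0.
Proof.
move=> xE; rewrite /potential sourceE step'_gt2 ?mul0r ?mulr0 ?mul0r//.
by rewrite ltr_pdivlMr.
Qed.

(** The factor [4 K] bounds [2 (s/E) step'(s/E)] for [s <= 2E]; the rest is the numerical part of
    the bound of [ground_ge], raised to the negative power [1 - p]. *)
Definition potential_const : R := 4 * K * (4 `^ (- decay - 1)) `^ (1 - p).

Lemma potential_const_ge0 : 0 <= potential_const.
Proof. by rewrite !mulr_ge0 ?powR_ge0// (le_trans _ (stepK 0)). Qed.

Lemma source_bound s : s <= 2 * E -> `|source s| <= 4 * K * E `^ (- (n%:R / 2)).
Proof.
move=> s2; have K0 : 0 <= K by exact: le_trans (stepK 0).
rewrite sourceE; have [sE|sE] := ltP s E.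
  rewrite step'_lt1 ?mul0r ?mulr0 ?mul0r ?normr0 ?mulr_ge0 ?powR_ge0//.
  by rewrite ltr_pdivrMr// mul1r.
have s0 : 0 < s by exact: lt_le_trans sE.
rewrite normrM [X in _ * X]ger0_norm ?powR_ge0//; apply: ler_pM => //.
- exact: powR_ge0.
- rewrite !normrM normfV (gtr0_norm s0) (gtr0_norm E0) ger0_norm// [X in _ * X]mulrC mulrA.
  apply: ler_pM => //; rewrite ?mulr_ge0 ?invr_ge0 ?(ltW s0) ?(ltW E0)//.
  by rewrite ler_pdivrMr//; have := E0; lra.
- by apply: ler_powRN; rewrite ?divr_ge0.
Qed.

(** The source contributes [E^(-n/2)], and [u >= 4^(-decay-1) E^(-decay)] contributes
    [E^(decay (p-1)) = E^((n-p)/2)]; together they give [E^(-p/2)]. *)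
Lemma potential_bound x : `|V x| <= potential_const * E `^ (- (p / 2)).
Proof.
have [xE|xE] := ltP (2 * E) (sqn x).
  by rewrite potential_out// normr0 mulr_ge0 ?powR_ge0// potential_const_ge0.
have K0 : 0 <= K by exact: le_trans (stepK 0).
rewrite normrM [X in _ * X]ger0_norm ?powR_ge0//.
have m0 : 0 < E * (4 * E) `^ (- decay - 1) by rewrite mulr_gt0 ?powR_gt0// mulr_gt0.
have H : u x `^ (1 - p) <= (E * (4 * E) `^ (- decay - 1)) `^ (1 - p).
  rewrite -opprB; apply: ler_powRN => //; last exact: ground_ge.
  by rewrite subr_ge0 ltW.
apply: le_trans (ler_pM (normr_ge0 _) (powR_ge0 _ _) (source_bound xE) H) _.
rewrite /potential_const -!mulrA !ler_wpM2l//.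
rewrite (@powRM _ 4 E) ?(ltW E0)// [E * _]mulrCA powRM ?powR_ge0//; last first.
  by rewrite mulr_ge0 ?powR_ge0 ?(ltW E0).
rewrite mulrCA ler_wpM2l ?powR_ge0//.
rewrite -[X in X * _ `^ (- decay - 1)](powRr1 (ltW E0)).
rewrite -powRD ?(gt_eqF E0) ?implybT// -powRrM -powRD ?(gt_eqF E0) ?implybT//.
rewrite (_ : - (n%:R / 2) + (1 + (- decay - 1)) * (1 - p) = - (p / 2))//.
rewrite /decay; field.
by rewrite subr_eq0 gt_eqF.
Qed.

Lemma measurable_potential : measurable_fun setT V.
Proof.
apply: measurable_funM; first exact: continuous_measurable_rV continuous_source.
apply: (measurableT_comp (measurable_powR (1 - p))).
exact: continuous_measurable_rV continuous_ground.
Qed.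

Lemma integrable_potential : (lebesgue_rV n).-integrable (unit_ball n) (EFin \o V).
Proof.
apply: (bounded_integrable measurable_unit_ball (@unit_ball_cube _ _)).
  exact: measurable_on_ball measurable_potential.
by move=> x _; exact: potential_bound.
Qed.

(** The potential vanishes where [|x|^2 > 2E], so its support lies in the cube of half-side
    [sqrt(2E)], whose volume multiplies the uniform bound. *)
Lemma integral_potential_le r : 0 < r ->
  (\int[lebesgue_rV n]_(x in unit_ball n) (`|V x| `^ r)%:E <=
   ((potential_const * E `^ (- (p / 2))) `^ r * (Num.sqrt (2 * E) *+ 2) ^+ n)%:E)%E.
Proof.
move=> r0; set B := potential_const * _.
have B0 : 0 <= B by rewrite mulr_ge0 ?powR_ge0// potential_const_ge0.
have E20 : 0 < 2 * E by rewrite mulr_gt0.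
pose c := Num.sqrt (2 * E); have c0 : 0 < c by rewrite sqrtr_gt0.
rewrite EFinM -lebesgue_cube// -integral_cst; last exact: measurable_cube.
rewrite integral_mkcond [X in (X <= _)%E]integral_mkcond; apply: ge0_le_integral => //.
- by move=> x _; rewrite patchE; case: ifPn => // _; rewrite lee_fin powR_ge0.
- apply/(measurable_restrictT _ measurable_unit_ball)/measurable_EFinP.
  exact: measurable_norm_powR (measurable_on_ball measurable_potential).
- by apply/(measurable_restrictT _ (measurable_cube c)); exact: measurable_cst.
- move=> x _; rewrite !patchE; case: ifPn => xD; last first.
    by case: ifPn => // _; rewrite lee_fin powR_ge0.
  have [xE|xE] := ltP (2 * E) (sqn x).
    rewrite potential_out// normr0 powR0 ?gt_eqF//.
    by case: ifPn => // _; rewrite lee_fin powR_ge0.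
  rewrite mem_set; last by apply: sqn_le_cube; rewrite ?(ltW c0)// sqr_sqrtr// ltW.
  by rewrite lee_fin ge0_ler_powR ?nnegrE ?(ltW r0)// potential_bound.
Qed.

End construction.

Theorem theorem2p5 (R : realType) (n : nat) (p : R) (hp1 : 1 < p)
    (hpn : p < n%:R) (r : R) (hr1 : 1 <= r) (hrn : r < n%:R / p)
    (delta : R) (hdelta : 0 < delta) :
  exists (V u : 'rV[R]_n -> R) (G : 'rV[R]_n -> 'rV[R]_n),
    [/\ (lebesgue_rV n).-integrable (unit_ball n) (EFin \o V),
        sobolev0 (unit_ball n) p u G,
        ~ {ae lebesgue_rV n, forall x, unit_ball n x -> u x = 0},
        p_laplace_solution (unit_ball n) p V u G
      & (LnormD (unit_ball n) r V < delta%:E)%E].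
Proof.
have p0 : 0 < p by exact: lt_trans hp1.
have r0 : 0 < r by exact: lt_le_trans hr1.
have [step' [K [dstep stepK step'_lt1 step'_gt2]]] := @derive_step_bounded R.
(* The power of [E] in the bound for the integral of [|V|^r]: [n/2] from the volume and [-p r/2]
   from the size of [V]. *)
pose kappa : R := (n%:R - p * r) / 2.
have kappa0 : 0 < kappa.
  by rewrite divr_gt0// subr_gt0 mulrC -ltr_pdivlMr.
pose C0 : R := @potential_const R n p K.
have C00 : 0 <= C0 := potential_const_ge0 p stepK.
pose C1 : R := C0 `^ r * (Num.sqrt 2 *+ 2) ^+ n.
have C10 : 0 <= C1 by rewrite mulr_ge0 ?powR_ge0// exprn_ge0// mulrn_wge0 ?sqrtr_ge0.
have C11 : 0 < C1 + 1 by rewrite ltr_wpDl.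
(* The first bound ensures [4E <= 1], the second [(C1 + 1) E^kappa <= delta^r]. The added 1 makes
   the division legitimate and the final inequality strict. *)
pose E : R := Num.min 4^-1 ((delta `^ r / (C1 + 1)) `^ kappa^-1).
have b0 : 0 < delta `^ r / (C1 + 1) by rewrite divr_gt0 ?powR_gt0.
have E0 : 0 < E by rewrite lt_min invr_gt0 ?powR_gt0 ?ltr0n.
have E4 : 4 * E <= 1 by rewrite -ler_pdivlMl// mulr1 ge_min lexx.
have EC : C1 * E `^ kappa < delta `^ r.
  have Ek : E `^ kappa <= delta `^ r / (C1 + 1).
    have -> : delta `^ r / (C1 + 1) = ((delta `^ r / (C1 + 1)) `^ kappa^-1) `^ kappa.
      by rewrite -powRrM mulVf ?gt_eqF// powRr1// ltW.
    by rewrite ge0_ler_powR ?nnegrE ?powR_ge0 ?(ltW kappa0) ?(ltW E0)// ge_min lexx orbT.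
  apply: le_lt_trans (ler_wpM2l C10 Ek) _.
  by rewrite mulrA ltr_pdivrMr// mulrC ltr_pM2l ?powR_gt0// ltrDl.
have [P dP] : exists P : R -> R, forall s : R, is_derive s 1 P (2^-1 * @slope R n p E s).
  apply: (antiderivative _ E0) => [s|s sE]; last by rewrite slope_eq0 ?mulr0.
  apply: continuous_mul; first exact: cst_continuous.
  exact: Cdir_cont (C1_slope hp1 E0 0).
exists (potential p E P step'), (ground P), (ground_grad p E); split.
- exact: (integrable_potential hp1 hpn E0 E4 dP dstep stepK step'_lt1 step'_gt2).
- exact: sobolev0_ground.
- move=> u0; apply: (@unit_ball_nonnegligible R n); apply: filterS u0 => x u0 Dx.
  have : 0 < ground P x by rewrite (ground_gt0 hp1 E0 E4 dP) -unit_ballE.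
  by rewrite u0// ltxx.
- exact: solution_ground.
- apply: LnormD_lt => //.
  apply: le_lt_trans (integral_potential_le hp1 hpn E0 E4 dP
    dstep stepK step'_lt1 step'_gt2 r0) _.
  (* The bound equals [C1 * E^kappa]: the powers of [E] are collected from [(C0 E^(-p/2))^r] and
     from [(2 sqrt(2E))^n]. *)
  rewrite lte_fin; apply: le_lt_trans EC; rewrite le_eqVlt; apply/orP; left; apply/eqP.
  rewrite powRM ?powR_ge0// -powRrM sqrtrM// -mulrnAl exprMn mulrACA; congr (_ * _).
  rewrite -powR12_sqrt ?(ltW E0)// -powR_mulrn ?powR_ge0// -powRrM.
  rewrite -powRD ?(gt_eqF E0) ?implybT//; congr (_ `^ _).
  by rewrite /kappa; field.
Qed.
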